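(* Let $(\Sigma,\sigma)$ be a transitive countable Markov shift with finite topological entropy. Let $(\mu_n)_n$ be a sequence of $\sigma$-invariant probability measures converging on cylinders to $\mu$ (a $\sigma$-invariant measure with $|\mu|:=\mu(\Sigma)\in[0,1]$). Then $$\limsup_{n\to\infty} h_{\mu_n}(\sigma)\le |\mu|\,h_{\mu/|\mu|}(\sigma)+(1-|\mu|)\,\delta_\infty .$$ If the sequence converges on cylinders to the zero measure, then the right hand side is understood as $\delta_\infty$.
   Context: $\mathbb{N}=\{1,2,\dots\}$, $\mathbb{N}_0=\mathbb{N}\cup\{0\}$. A (one-sided) countable Markov shift (CMS) $(\Sigma,\sigma)$ is given by a matrix $(A(i,j))_{i,j\in\mathbb{N}}$ with entries in $\{0,1\}$: $\Sigma=\{(x_0,x_1,\dots)\in\mathbb{N}^{\mathbb{N}_0}: A(x_i,x_{i+1})=1\ \forall i\in\mathbb{N}_0\}$ with the topology induced from the product topology ($\mathbb{N}$ discrete), and $\sigma$ is the left shift. A word $a_0\ldots a_{N-1}$ is admissible if $A(a_i,a_{i+1})=1$ for $0\le i\le N-2$; the cylinder of length $N$ is $[a_0,\ldots,a_{N-1}]=\{x\in\Sigma: x_i=a_i,\ 0\le i\le N-1\}$ (cylinders counted below are those of admissible words). $(\Sigma,\sigma)$ is transitive if its directed graph (vertices $\mathbb{N}$, an edge $i\to j$ iff $A(i,j)=1$) is connected in the directed sense: for all $a,b\in\mathbb{N}$ some admissible word starts at $a$ and ends at $b$. Measures are Borel. A sequence $(\mu_n)_n$ of $\sigma$-invariant measures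 of mass at most $1$ converges on cylinders to a $\sigma$-invariant measure $\mu$ of mass at most $1$ if $\mu_n(C)\to\mu(C)$ for every cylinder $C$. $h_\nu(\sigma)$ is the measure-theoretic (Kolmogorov–Sinai) entropy of an invariant probability measure $\nu$. For a transitive CMS the topological (Gurevich) entropy is $h_{top}(\sigma)=\limsup_{n\to\infty}\frac1n\log\#\{x\in\Sigma:\sigma^n x=x,\ x_0=a\}$, independent of $a\in\mathbb{N}$. Topological entropy at infinity: for $M,q,n\in\mathbb{N}$ let $z_n(M,q)$ be the number of cylinders $[x_0,\ldots,x_{n+1}]$ with $x_0\le q$, $x_{n+1}\le q$ and $\#\{i\in\{0,\ldots,n+1\}:x_i\le q\}\le\frac{n+2}{M}$. Put $\delta_\infty(M,q)=\limsup_{n\to\infty}\frac1n\log z_n(M,q)$, $\delta_\infty(q)=\liminf_{M\to\infty}\delta_\infty(M,q)$, and $\delta_\infty=\liminf_{q\to\infty}\delta_\infty(q)$. *)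

(* Defs.v *)
From HB Require Import structures.
From mathcomp Require Import all_boot all_order all_algebra.
From mathcomp Require Import all_classical all_reals all_analysis.

Set Implicit Arguments.
Unset Strict Implicit.
Unset Printing Implicit Defensive.

Import Order.TTheory GRing.Theory Num.Theory.
Import numFieldNormedType.Exports.

Local Open Scope classical_set_scope.
Local Open Scope ring_scope.

(* The alphabet {1, 2, ...} is encoded by nat with letter k : nat standing for
   k + 1; thus "x_i <= q" reads (x i < q)%N below. A transition matrix with
   entries in {0, 1} is a boolean relation A : rel nat, and a word w is
   admissible when sorted A w, i.e. when consecutive letters are A-related. *)

Definition cms_transitive (A : rel nat) : Prop :=
  forall a b : nat, exists2 p : seq nat, path A a p & last a p = b.

Definition cms_set (A : rel nat) : set {ptws nat -> nat} :=
  [set x | forall i, A (x i) (x i.+1)].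

Lemma cms_transitive_succ (A : rel nat) (tA : cms_transitive A) (a : nat) :
  exists b, A a b.
Proof.
have [[|b p] /= pA pE] := tA a a.+1; first by move/n_Sn: pE.
by exists b; case/andP: pA.
Qed.

Lemma cms_transitive_nonempty (A : rel nat) (tA : cms_transitive A) :
  (fun i => iter i (fun a => xchoose (cms_transitive_succ tA a)) 0%N)
    \in cms_set A.
Proof.
by apply/mem_set => i /=; exact: (xchooseP (cms_transitive_succ tA _)).
Qed.

(* The shift space with the topology induced by the product topology on
   nat -> nat. The transitivity proof is a parameter only because measurable
   types of the library are pointed. *)
Definition cms (A : rel nat) (tA : cms_transitive A) : Type :=
  set_type (cms_set A).

Section cms_structures.
Variables (A : rel nat) (tA : cms_transitive A).

HB.instance Definition _ :=
  Topological.copy (cms tA) (set_type (cms_set A)).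
HB.instance Definition _ :=
  isPointed.Build (cms tA)
    (exist (fun x => x \in cms_set A) _ (cms_transitive_nonempty tA)).
HB.instance Definition _ :=
  Measurable.copy (cms tA) (g_sigma_algebraType (@open (cms tA))).

End cms_structures.

Section cms_definitions.
Variables (A : rel nat) (tA : cms_transitive A).

Lemma cms_shift_subproof (x : cms tA) :
  (fun i => set_val x i.+1) \in cms_set A.
Proof. by apply/mem_set => i; exact: (set_valP x). Qed.

Definition cms_shift (x : cms tA) : cms tA :=
  exist (fun y => y \in cms_set A) _ (cms_shift_subproof x).

Definition cylinder (w : seq nat) : set (cms tA) :=
  [set x | forall i, (i < size w)%N -> set_val x i = nth 0%N w i].

Definition periodic_points (a n : nat) : set (cms tA) :=
  [set x | iter n cms_shift x = x /\ set_val x 0%N = a].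

(* The word is x_0 ... x_(n+1), and the cardinality condition
   #{i | x_i <= q} <= (n + 2) / M is cleared of denominators.
   M, q, n matter only in the limit, so M = 0 or q = 0 is harmless. *)
Definition escaping_words (M q n : nat) : set (seq nat) :=
  [set w | [/\ size w = n.+2, sorted A w,
               (nth 0 w 0 < q)%N, (nth 0 w n.+1 < q)%N &
               (count (fun k => (k < q)%N) w * M <= n.+2)%N]].

Definition escaping_cylinders (M q n : nat) : set (set (cms tA)) :=
  [set cylinder w | w in escaping_words M q n].

End cms_definitions.

Arguments cylinder {A} tA w.
Arguments periodic_points {A} tA a n.
Arguments escaping_cylinders {A} tA M q n.

Section growth.
Variable R : realType.
Local Open Scope ereal_scope.

(* limsup (1/n) log c_n, with log 0 = -oo and log +oo = +oo *)
Definition growth_rate (c : nat -> \bar R) : \bar R :=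
  limn_esup (fun n => (n%:R^-1)%:E * lne (c n)).

Variables (A : rel nat) (tA : cms_transitive A).

(* By transitivity this does not depend on the letter a. *)
Definition gurevich_entropy (a : nat) : \bar R :=
  growth_rate (fun n => counting (periodic_points tA a n)).

Definition delta_infty_Mq (M q : nat) : \bar R :=
  growth_rate (fun n => counting (escaping_cylinders tA M q n)).

Definition delta_infty_q (q : nat) : \bar R :=
  limn_einf (fun M => delta_infty_Mq M q).

Definition delta_infty : \bar R := limn_einf delta_infty_q.

End growth.

Section entropy.
Context {d : measure_display} {T : measurableType d} {R : realType}.
Variables (f : T -> T) (m : set T -> \bar R).

Definition invariant_measure : Prop :=
  forall B, measurable B -> m (f @^-1` B) = m B.

Definition measurable_partition (k : nat) (P : 'I_k -> set T) : Prop :=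
  [/\ forall i, measurable (P i), trivIset setT P & \bigcup_i P i = setT].

(* The cell of the join of P, f^-1 P, ..., f^-(n-1) P with itinerary w *)
Definition join_cell (k : nat) (P : 'I_k -> set T) (n : nat)
    (w : {ffun 'I_n -> 'I_k}) : set T :=
  \bigcap_i (iter (i : 'I_n) f @^-1` P (w i)).

(* Natural logarithm; ln 0 = 0 in the library, hence 0 ln 0 = 0. *)
Definition join_entropy (k : nat) (P : 'I_k -> set T) (n : nat) : R :=
  - \sum_(w : {ffun 'I_n -> 'I_k})
      fine (m (join_cell P w)) * ln (fine (m (join_cell P w))).

Definition partition_entropy (k : nat) (P : 'I_k -> set T) : \bar R :=
  limn (fun n => (join_entropy P n / n%:R)%:E).

Definition ks_entropy : \bar R :=
  ereal_sup [set h | exists k, exists2 P : 'I_k -> set T,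
                       measurable_partition P & h = partition_entropy P].

End entropy.

(* Main.v *)
Require Import Defs.
From HB Require Import structures.
From mathcomp Require Import all_boot all_order all_algebra.
From mathcomp Require Import all_classical all_reals all_analysis.
From mathcomp Require Import finmap ring lra zify.

Set Implicit Arguments.
Unset Strict Implicit.
Unset Printing Implicit Defensive.

Import Order.TTheory GRing.Theory Num.Theory.
Import numFieldNormedType.Exports.

Local Open Scope classical_set_scope.
Local Open Scope ring_scope.

(** Let nu be an invariant probability measure, and replace every letter by
its truncation [minn m0 x]: letters [>= m0] become the single symbol [m0],
written * below. The entropy is compared with that of the truncated process,
first uniformly in nu, then in the limit along [mu_].

Uniform comparison. For every [q > 0] and every [kappa >= 0] above the growth rate
of the escaping words with parameters [M] and [q] there is [m0] such that every
invariant nu satisfies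
    [h_nu <= h_nu(truncation at m0) + kappa * nu(x_0 >= q)]
([ks_entropy_truncation]). By the generator theorem [ks_generator] it is enough
to bound the entropy of the truncation at a large [m], hence to count the
[m]-truncated words of length n that refine a given [m0]-truncated word
([entropy_rate_card]). Cut the word at its letters [< q]. By finite entropy
there are finitely many paths of bounded length between letters [< q], so for
[m0] large a short excursion away from these letters shows no * and has a single
refinement, while a long excursion is an escaping word, of which there are at
most [expR (kappa * length)] ([refinements_excursion]). The first and last
pieces may never come back, because nu may live far from the letters [< q]; but
outer runs of the symbol [m] carry no information in the [m]-truncated word, and
what remains joins two letters [< m], so that bounded connecting paths turn it
into an escaping word as well
([refinements_few_visits]). The total is a polynomial in n times [expR] of
[kappa] times the number of letters [>= q] ([refinements_bound]).

Passage to the limit. The entropy of the truncated process is at most 1/N times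
the entropy of its N-blocks (Fekete), a finite sum over cells. A cell with some
coordinate other than * lies in a set [x_i = c], and there no mass escapes:
convergence on cylinders gives convergence on all its subsets that depend on
finitely many coordinates ([cvg_determined]). The cell ** ... * takes all the
escaping mass, but a single cell contributes at most 1, which disappears after
division by N. The N-block entropy of the limit [mu] itself is |mu| times that
of mu/|mu| minus |mu| ln |mu|, and N tends to infinity ([limsup_ks_rate]).

Finally [q] tends to infinity along values for which some [M] has growth rate
close to [delta_infty], and the mass of [x_0 < q] tends to |mu|. The rate
[kappa] may be taken close to [delta_infty] because [delta_infty >= 0]: an
infinite strongly connected graph of finite entropy has arbitrarily long
excursions ([delta_infty_Mq_ge0]). *)

(** * Preliminaries on reals and finite sums *)

Lemma eq_ler (R : realType) (x y : R) : x = y -> x <= y.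
Proof. by move=> ->. Qed.

Lemma expR_dominates (R : realType) (K : R) :
  exists n0, forall n, (n0 <= n)%N -> K <= expR n%:R.
Proof.
exists (Num.truncn `|K|).+1 => n Kn.
apply: le_trans (expR_ge1Dx _).
have : `|K| < n%:R.
  by apply: lt_le_trans (truncnS_gt _) _; rewrite ler_nat.
by have := ler_norm K; lra.
Qed.

Lemma ln_le_linear (R : realType) (e : R) : 0 < e -> exists C : R, forall n : nat,
  ln n.+1%:R <= C + e * n%:R.
Proof.
move=> e0; exists (e - ln e) => n.
have := ltW (ln_sublinear (mulr_gt0 e0 (ltr0Sn R n))).
by rewrite lnM ?posrE// -natr1 mulrDr mulr1; lra.
Qed.

Lemma cvg_inv_nat (R : realType) : (fun n => n%:R^-1) @ \oo --> (0 : R).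
Proof. by rewrite -cvg_shiftS; exact: cvg_harmonic. Qed.

Lemma sumr_pair (R : realType) (F G : finType) (g : F * G -> R) :
  \sum_c g c = \sum_a \sum_b g (a, b).
Proof. by rewrite pair_bigA/=; apply: eq_bigr => -[]. Qed.

Lemma sumr_fiber (R : realType) (F G : finType) (g : F * G -> R) (a : F) (D : pred G) :
  \sum_(c | (c.1 == a) && D c.2) g c = \sum_(b | D b) g (a, b).
Proof.
rewrite big_mkcond sumr_pair (bigD1 a)//= [X in _ + X]big1 ?addr0.
  by rewrite [RHS]big_mkcond/=; apply: eq_bigr => b _; rewrite eqxx.
by move=> a' /negbTE a'a; rewrite big1// => b _; rewrite a'a.
Qed.

Lemma count_enum (F : finType) (b : pred F) : count b (enum F) = #|b|.
Proof.
rewrite cardE -size_filter /enum_mem -filter_predI; congr (size _).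
by apply: eq_filter => x; rewrite /= andbT.
Qed.

(** * Shannon entropy of finite distributions *)

Section gibbs.
Context {R : realType}.
Implicit Types (F G : finType) (t r : R).

(** The tangent of the concave function [- t ln t] at [r] lies above it. Every
entropy inequality of this file reduces to this one. *)
Lemma gibbs_scalar t r : 0 <= t -> 0 < r -> - (t * ln t) <= - (t * ln r) + (r - t).
Proof.
rewrite le_eqVlt => /predU1P[<-|t0] r0.
  by rewrite !mul0r oppr0 add0r addr0 ltW.
have rt0 : 0 < r / t by rewrite divr_gt0.
have h : ln (r / t) <= r / t - 1.
  by rewrite -[X in ln X](subrKC 1) le_ln1Dx// ltrBrDl addrN.
rewrite ln_div ?posrE// in h.
have := ler_wpM2l (ltW t0) h.
by rewrite !mulrBr mulrCA mulfV ?gt_eqF// !mulr1; lra.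
Qed.

(** Upper semicontinuity is all that the passage to the limit uses. It follows
from the tangent at [c], or at a small positive point when [c = 0]. *)
Lemma neg_xlnx_upper (c e : R) : 0 <= c -> 0 < e ->
  exists2 d : R, 0 < d & forall t, 0 <= t -> `|t - c| <= d ->
    - (t * ln t) <= - (c * ln c) + e.
Proof.
move=> c0 e0; pose r := if c == 0 then e / 2 else c.
have r0 : 0 < r.
  by rewrite /r; case: eqVneq => [_|cn]; [rewrite divr_gt0|rewrite lt_neqAle eq_sym cn].
have L0 : 0 < `|ln r| + 1 by rewrite ltr_wpDl.
exists ((e / 2) / (`|ln r| + 1)); first by rewrite !divr_gt0.
move=> t t0; rewrite ler_pdivlMr// => ht.
apply: le_trans (gibbs_scalar t0 r0) _.
have h1 : - ((t - c) * ln r) <= `|t - c| * `|ln r|.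
  by rewrite -normrM -normrN ler_norm.
have h2 : - (t - c) <= `|t - c| by rewrite -normrN ler_norm.
have h3 : - (t * ln r) + (c - t) <= - (c * ln r) + e / 2 by lra.
have h4 : - (c * ln r) + (r - c) <= - (c * ln c) + e / 2.
  by rewrite /r; case: eqVneq => [->|_]; lra.
lra.
Qed.

Definition shannon F (p : F -> R) : R := - \sum_a p a * ln (p a).

(** The subprobability [r] may be chosen freely: an upper bound of an entropy
amounts to a good guess [r] of the distribution [p]. *)
Lemma gibbs F (p r : F -> R) : (forall a, 0 <= p a) -> (forall a, 0 <= r a) ->
  (forall a, 0 < p a -> 0 < r a) -> \sum_a r a <= \sum_a p a ->
  shannon p <= \sum_a p a * - ln (r a).
Proof.
move=> p0 r0 pr rp; rewrite /shannon -sumrN.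
apply: (@le_trans _ _ (\sum_a (p a * - ln (r a) + (r a - p a)))).
  apply: ler_sum => a _.
  have := p0 a; rewrite le_eqVlt => /predU1P[<-|pa].
    by rewrite !mul0r oppr0 add0r addr0.
  by rewrite mulrN gibbs_scalar// pr.
by rewrite big_split/= sumrB gerDl subr_le0.
Qed.

Lemma shannon_ge0 F (p : F -> R) : (forall a, 0 <= p a <= 1) -> 0 <= shannon p.
Proof.
move=> p01; rewrite /shannon -sumrN sumr_ge0// => a _.
have /andP[p0 p1] := p01 a.
by rewrite -mulrN mulr_ge0// oppr_ge0 ln_le0.
Qed.

Lemma shannon_scale F (p : F -> R) (l : R) :
  0 < l -> (forall a, 0 <= p a) -> \sum_a p a = 1 ->
  shannon (fun a => l * p a) = l * shannon p - l * ln l.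
Proof.
move=> l0 p0 p1; rewrite /shannon mulrN -opprD; congr (- _).
transitivity (\sum_a (l * (p a * ln (p a)) + l * ln l * p a)); last first.
  by rewrite big_split/= -!mulr_sumr p1 mulr1.
apply: eq_bigr => a _; have := p0 a; rewrite le_eqVlt => /predU1P[<-|pa].
  by rewrite !(mulr0, mul0r) addr0.
by rewrite lnM ?posrE//; ring.
Qed.

End gibbs.

(** * Subadditive sequences *)

Section fekete.
Context {R : realType}.
Variable a : nat -> R.
Hypothesis a0 : forall n, 0 <= a n.
Hypothesis aD : forall m n, a (m + n)%N <= a m + a n.

Let aM N k r : a (k * N + r)%N <= k%:R * a N + a r.
Proof.
elim: k => [|k IH]; first by rewrite mul0n add0n mul0r add0r.
rewrite mulSn -addnA (le_trans (aD _ _))// -natr1 mulrDl mul1r.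
by rewrite [_ + a N]addrC -addrA lerD2l.
Qed.

(** Fekete's lemma: write [n = k * N + r] and compare [a n] with [k * a N]. *)
Lemma fekete : exists2 l : R, (fun n => a n / n%:R) @ \oo --> l &
  forall N, (0 < N)%N -> l <= a N / N%:R.
Proof.
pose S := [set a n.+1 / n.+1%:R | n in [set: nat]].
have hiS : has_inf S.
  split; first by exists (a 1%N / 1%:R), 0%N.
  by exists 0 => _ [n _ <-]; rewrite divr_ge0.
have lS N : (0 < N)%N -> inf S <= a N / N%:R.
  by case: N => // N _; apply: ge_inf; [exact: hiS.2|exists N].
exists (inf S) => //.
apply/cvgrPdist_le => e e0.
have [_ [N _ <-] aN] := inf_adherent (divr_gt0 e0 (ltr0n R 2)) hiS.
pose C := \sum_(r < N.+1) a r.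
have arC r : (r < N.+1)%N -> a r <= C.
  move=> rN; rewrite /C (bigD1 (Ordinal rN))//= lerDl sumr_ge0//.
have C0 : 0 <= C by rewrite sumr_ge0.
near=> n.
have n0 : (0 < n)%N by near: n; exact: nbhs_infty_gt.
have nR : (0 : R) < n%:R by rewrite ltr0n.
have Cn : C / n%:R <= e / 2.
  rewrite ler_pdivrMr// mulrC -ler_pdivrMr; last by rewrite divr_gt0.
  by near: n; exact: nbhs_infty_ger.
rewrite distrC ger0_norm ?subr_ge0 ?lS//.
rewrite lerBlDl (le_trans _ (_ : inf S + e / 2 + e / 2 <= _)); last first.
  by rewrite -addrA -splitr.
apply: le_trans (lerD (ltW aN) Cn).
rewrite {1}(divn_eq n N.+1).
have := aM N.+1 (n %/ N.+1) (n %% N.+1).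
rewrite ler_pdivrMr// mulrDl divfK ?gt_eqF// => /le_trans; apply.
apply: lerD; last by rewrite arC// ltn_pmod.
rewrite mulrC -mulrA ler_wpM2l// ler_pdivlMl//.
rewrite mulrC -natrM ler_nat; exact: leq_divM.
Unshelve. all: by end_near. Qed.

End fekete.

(** * Finite-valued observables and their laws *)

Section observables.
Context {d : measure_display} {T : measurableType d} {R : realType}.
Variable P : probability T R.
Implicit Types (F G : finType).

Definition law F (X : T -> F) (a : F) : R := fine (P (X @^-1` [set a])).

(** On a finite codomain, measurability is measurability of the fibres; this
spares a sigma-algebra on the codomain. *)
Definition observable F (X : T -> F) := forall a, measurable (X @^-1` [set a]).

Lemma law_ge0 F (X : T -> F) a : 0 <= law X a.
Proof. exact/fine_ge0/measure_ge0. Qed.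

Lemma preimage_observable F (X : T -> F) (D : set F) : observable X ->
  measurable (X @^-1` D).
Proof.
move=> mX; rewrite (_ : X @^-1` D = \bigcup_(a in D) X @^-1` [set a]).
  by apply: fin_bigcup_measurable => // a _; exact: mX.
by apply/seteqP; split => [x Dx|x [a Da /= ->]]//; exists (X x).
Qed.

Lemma observable_comp F G (X : T -> F) (h : F -> G) : observable X ->
  observable (h \o X).
Proof. by move=> mX b; exact: (preimage_observable (h @^-1` [set b])). Qed.

Lemma observable_pair F G (X : T -> F) (Y : T -> G) : observable X ->
  observable Y -> observable (fun x => (X x, Y x)).
Proof.
move=> mX mY [a b].
rewrite (_ : _ @^-1` _ = X @^-1` [set a] `&` Y @^-1` [set b]).
  exact: measurableI.
by apply/seteqP; split => x /= [E1 E2]; rewrite E1 E2.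
Qed.

Lemma law_mem F (X : T -> F) (s : seq F) : observable X -> uniq s ->
  fine (P (X @^-1` [set a | a \in s])) = \sum_(a <- s) law X a.
Proof.
move=> mX; elim: s => [|a s IH] /=.
  move=> _; rewrite big_nil (_ : X @^-1` _ = set0) ?measure0//.
  by apply/seteqP; split.
case/andP => as_ us; rewrite big_cons -IH// /law.
rewrite -fineD; last 2 first.
- exact: fin_num_measure (mX a).
- exact: fin_num_measure (preimage_observable _ mX).
rewrite -measureU; last 3 first.
- exact: mX.
- exact: preimage_observable.
- by apply/seteqP; split => // x [/= -> ]; rewrite (negbTE as_).
congr (fine (P _)); apply/seteqP; split => x /=; rewrite in_cons.
  by case/predU1P; [left|right].
by case=> [->|->]; rewrite ?eqxx ?orbT.
Qed.

Lemma law_pred F (X : T -> F) (D : pred F) : observable X ->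
  fine (P (X @^-1` [set a | D a])) = \sum_(a | D a) law X a.
Proof.
move=> mX; rewrite -[RHS]big_filter.
rewrite -law_mem//; last by rewrite filter_uniq// index_enum_uniq.
by congr (fine (P _)); apply/seteqP; split => x /=;
  rewrite mem_filter mem_index_enum andbT.
Qed.

Lemma law_comp F G (X : T -> F) (h : F -> G) b : observable X ->
  law (h \o X) b = \sum_(a | h a == b) law X a.
Proof.
move=> mX; rewrite -law_pred//; congr (fine (P _)).
by apply/seteqP; split => x /= /eqP.
Qed.

Lemma law_sum1 F (X : T -> F) : observable X -> \sum_a law X a = 1.
Proof.
move=> mX; rewrite -(law_pred xpredT)// (_ : X @^-1` _ = setT).
  by rewrite probability_setT.
by apply/seteqP; split.
Qed.

Lemma law_expect F G (X : T -> F) (h : F -> G) (g : G -> R) : observable X ->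
  \sum_a law X a * g (h a) = \sum_b law (h \o X) b * g b.
Proof.
move=> mX; rewrite (partition_big h xpredT)//=; apply: eq_bigr => b _.
by rewrite law_comp// mulr_suml; apply: eq_bigr => a /eqP ->.
Qed.

Lemma law_le_comp F G (X : T -> F) (h : F -> G) a : observable X ->
  law X a <= law (h \o X) (h a).
Proof.
move=> mX; rewrite law_comp// (bigD1 a)//= lerDl sumr_ge0// => b _.
exact: law_ge0.
Qed.

Lemma law_le1 F (X : T -> F) a : observable X -> law X a <= 1.
Proof.
move=> mX; rewrite -(law_sum1 mX) (bigD1 a)//= lerDl sumr_ge0// => b _.
exact: law_ge0.
Qed.

Lemma shannon_law_ge0 F (X : T -> F) : observable X -> 0 <= shannon (law X).
Proof. by move=> mX; apply: shannon_ge0 => a; rewrite law_ge0 law_le1. Qed.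

(** The guess spreads the mass of each value [b] of [h \o X] evenly over the
at most [c b] values of [X] above it. *)
Lemma shannon_le_card F G (X : T -> F) (h : F -> G) (c : G -> R) :
  observable X ->
  (forall b, #|[pred a | (h a == b) && (0 < law X a)]|%:R <= c b) ->
  (forall b, 0 < c b) ->
  shannon (law X) <= shannon (law (h \o X)) + \sum_b law (h \o X) b * ln (c b).
Proof.
move=> mX hc c0.
pose r a := if 0 < law X a then law (h \o X) (h a) / c (h a) else 0.
have r0 a : 0 < law X a -> 0 < law (h \o X) (h a).
  by move=> /lt_le_trans; apply; exact: law_le_comp.
apply: (@le_trans _ _ (\sum_a law X a * - ln (r a))).
  apply: gibbs => [a|a|a a0|]; first exact: law_ge0.
  - by rewrite /r; case: ifP => // _; rewrite divr_ge0 ?law_ge0// ltW.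
  - by rewrite /r a0 divr_gt0// r0.
  rewrite law_sum1// -(law_sum1 (observable_comp h mX)).
  rewrite (partition_big h xpredT)//=; apply: ler_sum => b _.
  rewrite (eq_bigr (fun a => if 0 < law X a then law (h \o X) b / c b else 0)).
    rewrite -big_mkcondr/= sumr_const -mulr_natr -mulrA.
    apply: ler_piMr; first exact: law_ge0.
    rewrite ler_pdivrMl// mulr1; exact: le_trans (hc b).
  by move=> a /eqP hab; rewrite /r hab.
rewrite /shannon -sumrN -big_split/=.
under [leRHS]eq_bigr do rewrite -mulrN -mulrDr.
rewrite -(law_expect h (fun b => - ln (law (h \o X) b) + ln (c b)))//.
apply: ler_sum => a _.
have := law_ge0 X a; rewrite le_eqVlt => /predU1P[<-|a0]; first by rewrite !mul0r.
by rewrite /r a0 ln_div ?posrE ?r0// opprB addrC lexx.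
Qed.

Lemma shannon_comp F G (X : T -> F) (h : F -> G) : observable X ->
  shannon (law (h \o X)) <= shannon (law X).
Proof.
move=> mX; rewrite /shannon -!sumrN.
under eq_bigr do rewrite -mulrN.
rewrite -(law_expect h (fun b => - ln (law (h \o X) b)))//.
apply: ler_sum => a _; rewrite -mulrN.
have := law_ge0 X a; rewrite le_eqVlt => /predU1P[<-|a0]; first by rewrite !mul0r.
have ha := law_le_comp h a mX.
by rewrite ler_wpM2l ?law_ge0// lerN2 ler_ln ?posrE//; exact: lt_le_trans ha.
Qed.

Lemma shannon_pair F G (X : T -> F) (Y : T -> G) : observable X ->
  observable Y ->
  shannon (law (fun x => (X x, Y x))) <= shannon (law X) + shannon (law Y).
Proof.
move=> mX mY; have mXY := observable_pair mX mY.
set Z := fun x => _ in mXY *.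
have ZX a : 0 < law Z a -> 0 < law X a.1.
  by move=> /lt_le_trans; apply; exact: (law_le_comp fst).
have ZY a : 0 < law Z a -> 0 < law Y a.2.
  by move=> /lt_le_trans; apply; exact: (law_le_comp snd).
apply: (@le_trans _ _ (\sum_a law Z a * - ln (law X a.1 * law Y a.2))).
  apply: gibbs => [a|a|a a0|]; first exact: law_ge0.
  - by rewrite mulr_ge0 ?law_ge0.
  - by rewrite mulr_gt0 ?ZX ?ZY.
  rewrite law_sum1// sumr_pair/=.
  under eq_bigr do rewrite -mulr_sumr law_sum1// mulr1.
  by rewrite law_sum1.
rewrite /shannon -!sumrN.
under [in leRHS]eq_bigr do rewrite -mulrN.
under [X in _ + X]eq_bigr do rewrite -mulrN.
rewrite -(law_expect (X := Z) fst (fun b => - ln (law X b)))//.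
rewrite -(law_expect (X := Z) snd (fun b => - ln (law Y b)))// -big_split/=.
apply: ler_sum => a _.
have := law_ge0 Z a; rewrite le_eqVlt => /predU1P[<-|a0].
  by rewrite !mul0r addr0.
by rewrite -mulrDr lnM ?posrE ?ZX ?ZY// opprD.
Qed.

Lemma law_marginal F G (X : T -> F) (Y : T -> G) b : observable X ->
  observable Y -> \sum_a law (fun x => (X x, Y x)) (a, b) = law Y b.
Proof.
move=> mX mY; rewrite (law_comp snd b (observable_pair mX mY)).
rewrite [RHS]big_mkcond/= sumr_pair/=; apply: eq_bigr => a _.
by rewrite -big_mkcond/= big_pred1_eq.
Qed.

(** Pairs with [law Y c.2 = 0] have weight 0, so that the quotient does not
matter there. *)
Definition cond_entropy F G (X : T -> F) (Y : T -> G) : R :=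
  \sum_(c : F * G) law (fun x => (X x, Y x)) c *
    - ln (law (fun x => (X x, Y x)) c / law Y c.2).

(** If, for each value [a], the event [X = a] is [Y \in C a] up to two errors
of probability at most [eta], then [X] is nearly determined by [Y]. With
[t] the conditional probability of [a], the function [- t ln t] is at most
[1 - t] on [C a], and at most [K t + expR (- K)] elsewhere: taking [K] large
first and then [eta] small makes the bound small. *)
Lemma cond_entropy_le F G (X : T -> F) (Y : T -> G) (C : F -> pred G) (eta K : R) :
  observable X -> observable Y -> 0 <= K ->
  (forall a, \sum_(b | C a b) (law Y b - law (fun x => (X x, Y x)) (a, b)) <= eta) ->
  (forall a, \sum_(b | ~~ C a b) law (fun x => (X x, Y x)) (a, b) <= eta) ->
  cond_entropy X Y <= #|F|%:R * (eta + K * eta + expR (- K)).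
Proof.
move=> mX mY K0 h1 h2; have mXY := observable_pair mX mY.
rewrite /cond_entropy; set Z := fun x => _ in mXY h1 h2 *.
rewrite sumr_pair/=.
rewrite mulr_natl -sumr_const; apply: ler_sum => a _.
have ZY b : law Z (a, b) <= law Y b by exact: (law_le_comp snd (a, b) mXY).
apply: (@le_trans _ _ (\sum_(b | C a b) (law Y b - law Z (a, b)) +
   K * (\sum_(b | ~~ C a b) law Z (a, b)) + \sum_b law Y b * expR (- K))).
  rewrite (bigID (C a))/= -[in leRHS]addrA; apply: lerD.
    apply: ler_sum => b _.
    have := law_ge0 Z (a, b); rewrite le_eqVlt => /predU1P[<-|t0].
      by rewrite mul0r subr0 law_ge0.
    have s0 : 0 < law Y b by exact: lt_le_trans t0 (ZY b).
    have := gibbs_scalar (ltW t0) s0.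
    by rewrite ln_div ?posrE// mulrN mulrBr; lra.
  rewrite mulr_sumr.
  apply: (@le_trans _ _ (\sum_(b | ~~ C a b) (K * law Z (a, b) + law Y b * expR (- K)))).
    apply: ler_sum => b _.
    have := law_ge0 Z (a, b); rewrite le_eqVlt => /predU1P[<-|t0].
      by rewrite mul0r mulr0 add0r mulr_ge0 ?law_ge0 ?expR_ge0.
    have s0 : 0 < law Y b by exact: lt_le_trans t0 (ZY b).
    have := gibbs_scalar (ltW t0) (mulr_gt0 s0 (expR_gt0 (- K))).
    by rewrite ln_div ?posrE// lnM ?posrE ?expR_gt0// expRK mulrN mulrBr mulrDr; lra.
  rewrite big_split/= lerD2l [leRHS](bigID (C a))/= lerDr sumr_ge0// => b _.
  by rewrite mulr_ge0 ?law_ge0 ?expR_ge0.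
by rewrite -mulr_suml law_sum1// mul1r lerD2r lerD ?h1// ler_wpM2l.
Qed.

End observables.

(** * Entropy rates and Kolmogorov-Sinai entropy *)

Section dynamics.
Context {d : measure_display} {T : measurableType d} {R : realType}.
Variables (P : probability T R) (f : T -> T).
Hypothesis mf : measurable_fun setT f.
Hypothesis Pf : invariant_measure f P.
Implicit Types (F G : finType).

Lemma measurable_iter i B : measurable B -> measurable (iter i f @^-1` B).
Proof.
move=> mB; elim: i => [//|i IH].
rewrite (_ : _ @^-1` _ = f @^-1` (iter i f @^-1` B)).
  by rewrite -[X in measurable X]setTI; exact: mf.
by apply/seteqP; split => x /=; rewrite -iterSr.
Qed.

Lemma measure_iter i B : measurable B -> P (iter i f @^-1` B) = P B.
Proof.
move=> mB; elim: i => [//|i IH].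
rewrite (_ : _ @^-1` _ = f @^-1` (iter i f @^-1` B)).
  by rewrite Pf//; exact: measurable_iter.
by apply/seteqP; split => x /=; rewrite -iterSr.
Qed.

Definition itinerary n F (X : T -> F) (x : T) : {ffun 'I_n -> F} :=
  [ffun i : 'I_n => X (iter i f x)].

Lemma observable_iter F (X : T -> F) i : observable X -> observable (X \o iter i f).
Proof. by move=> mX a; exact: (measurable_iter i (mX a)). Qed.

Lemma law_iter F (X : T -> F) i : observable X -> law P (X \o iter i f) = law P X.
Proof.
by move=> mX; apply/funext => a; rewrite /law -(measure_iter i (mX a)).
Qed.

Lemma observable_itinerary n F (X : T -> F) : observable X -> observable (itinerary n X).
Proof.
move=> mX w.
rewrite (_ : _ @^-1` _ = \bigcap_(i in [set: 'I_n]) (X \o iter i f) @^-1` [set w i]).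
  by apply: fin_bigcap_measurable => // i _; exact: (observable_iter i mX).
apply/seteqP; split => x /=; first by move=> <- i _ /=; rewrite ffunE.
by move=> h; apply/ffunP => i; rewrite ffunE; exact: h.
Qed.

Definition block_entropy F (X : T -> F) n := shannon (law P (itinerary n X)).

Lemma block_entropy_ge0 F (X : T -> F) n : observable X -> 0 <= block_entropy X n.
Proof. by move=> mX; apply: shannon_law_ge0; exact: observable_itinerary. Qed.

Lemma block_entropyD F (X : T -> F) m n : observable X ->
  block_entropy X (m + n) <= block_entropy X m + block_entropy X n.
Proof.
move=> mX.
have mm := observable_itinerary (n := m) mX. have mn := observable_itinerary (n := n) mX.
have mn' := observable_iter m mn.
pose h (c : {ffun 'I_m -> F} * {ffun 'I_n -> F}) : {ffun 'I_(m + n) -> F} :=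
  [ffun i => match fintype.split i with inl j => c.1 j | inr j => c.2 j end].
have -> : block_entropy X (m + n) =
    shannon (law P (h \o (fun x => (itinerary m X x, (itinerary n X \o iter m f) x)))).
  congr (shannon (law P _)); apply/funext => x; apply/ffunP => i.
  rewrite !ffunE; case: splitP => j -> /=; rewrite !ffunE//.
  by rewrite addnC iterD.
apply: (le_trans (shannon_comp _ _ (observable_pair mm mn'))).
apply: (le_trans (shannon_pair _ mm mn')).
by rewrite law_iter.
Qed.

Definition entropy_rate F (X : T -> F) : R := lim ((fun n => block_entropy X n / n%:R) @ \oo).

Lemma cvg_entropy_rate F (X : T -> F) : observable X ->
  (fun n => block_entropy X n / n%:R) @ \oo --> entropy_rate X.
Proof.
move=> mX; have [l cl _] := fekete (fun n => block_entropy_ge0 n mX)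
  (fun m n => block_entropyD m n mX).
by apply/cvg_ex; exists l.
Qed.

Lemma entropy_rate_le F (X : T -> F) N : observable X -> (0 < N)%N ->
  entropy_rate X <= block_entropy X N / N%:R.
Proof.
move=> mX; have [l cl h] := fekete (fun n => block_entropy_ge0 n mX)
  (fun m n => block_entropyD m n mX).
by rewrite /entropy_rate (cvg_lim _ cl)//; exact: h.
Qed.

(** By invariance each coordinate of the itinerary has the law of [X]. *)
Lemma sumr_itinerary_marginal F (X : T -> F) n (g : F -> R) (i : 'I_n) : observable X ->
  \sum_w law P (itinerary n X) w * g (w i) = \sum_a law P X a * g a.
Proof.
move=> mX; rewrite (law_expect P (fun w : {ffun 'I_n -> F} => w i))//; last first.
  exact: observable_itinerary.
apply: eq_bigr => a _; rewrite -[in RHS](law_iter i mX); congr (law P _ a * _).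
by apply/funext => x /=; rewrite ffunE.
Qed.

(** The chain rule for itineraries in one application of [gibbs]: the guess
draws the itinerary of [Y] from its law, and then each symbol of [X] from its
conditional law given the simultaneous symbol of [Y] only, independently of
all others. *)
Lemma block_entropy_cond F G (X : T -> F) (Y : T -> G) n :
  observable X -> observable Y ->
  block_entropy X n <= block_entropy Y n + n%:R * cond_entropy P X Y.
Proof.
move=> mX mY; have mXY := observable_pair mX mY.
(* The joint itinerary, as a single sequence of pairs. *)
pose Z x := (X x, Y x).
pose W := itinerary n Z.
pose fstn (w : {ffun 'I_n -> F * G}) : {ffun 'I_n -> F} := [ffun i => (w i).1].
pose sndn (w : {ffun 'I_n -> F * G}) : {ffun 'I_n -> G} := [ffun i => (w i).2].
have fE : itinerary n X = fstn \o W by apply/funext => x; apply/ffunP => i; rewrite !ffunE.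
have sE : itinerary n Y = sndn \o W by apply/funext => x; apply/ffunP => i; rewrite !ffunE.
have mW : observable W by exact: observable_itinerary.
have mYn : observable (itinerary n Y) by exact: observable_itinerary.
rewrite /block_entropy {1}fE.
apply: (le_trans (shannon_comp _ _ mW)).
pose c (ab : F * G) := law P Z ab / law P Y ab.2.
have c0 ab : 0 <= c ab by rewrite divr_ge0 ?law_ge0.
have WZ w i : 0 < law P W w -> 0 < law P Z (w i).
  move=> /lt_le_trans; apply; rewrite -(law_iter i mXY).
  apply: le_trans (law_le_comp P (fun w : {ffun 'I_n -> F * G} => w i) w mW) _.
  by rewrite le_eqVlt; apply/orP; left; apply/eqP; congr (law P _ _);
    apply/funext => x /=; rewrite ffunE.
have cpos ab : 0 < law P Z ab -> 0 < c ab.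
  move=> h; rewrite divr_gt0//.
  exact: lt_le_trans h (law_le_comp P snd ab mXY).
have Wpos w : 0 < law P W w -> 0 < law P (itinerary n Y) (sndn w).
  by move=> /lt_le_trans; apply; rewrite sE law_le_comp.
have csum b : \sum_a c (a, b) <= 1.
  rewrite /c /= -mulr_suml law_marginal//.
  have := law_ge0 P Y b; rewrite le_eqVlt => /predU1P[<-|b0].
    by rewrite mul0r.
  by rewrite divff// gt_eqF.
pose r w := law P (itinerary n Y) (sndn w) * \prod_i c (w i).
have lnprod (w : {ffun 'I_n -> F * G}) : (forall i, 0 < c (w i)) ->
    ln (\prod_i c (w i)) = \sum_i ln (c (w i)) /\ 0 < \prod_i c (w i).
  move=> cw; elim/big_rec2: _ => [|i y1 y2 _ [IH y0]]; first by rewrite ln1.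
  by rewrite lnM ?posrE// IH mulr_gt0.
apply: (@le_trans _ _ (\sum_w law P W w * - ln (r w))).
  apply: gibbs => [w|w|w w0|]; first exact: law_ge0.
  - by rewrite mulr_ge0 ?law_ge0 ?prodr_ge0.
  - rewrite mulr_gt0 ?Wpos//.
    by have [] := lnprod w (fun i => cpos _ (WZ w i w0)).
  rewrite law_sum1// -(law_sum1 P mYn).
  rewrite (partition_big sndn xpredT)//=; apply: ler_sum => s _.
  rewrite /r (eq_bigr (fun w : {ffun 'I_n -> F * G} =>
    law P (itinerary n Y) s * \prod_i c (w i))); last first.
    by move=> w /eqP ->.
  rewrite -mulr_sumr ler_piMr ?law_ge0//.
  rewrite (reindex_onto (fun w : {ffun 'I_n -> F} => [ffun i => (w i, s i)]) fstn)/=; last first.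
    move=> w /eqP ws; apply/ffunP => i; rewrite !ffunE -ws ffunE.
    by case: (w i).
  rewrite (eq_bigl xpredT); last first.
    move=> w; rewrite (_ : sndn _ = s) ?eqxx/=.
      by apply/eqP/ffunP => i; rewrite !ffunE.
    by apply/ffunP => i; rewrite !ffunE.
  rewrite (eq_bigr (fun w : {ffun 'I_n -> F} => \prod_i c (w i, s i))); last first.
    by move=> w _; apply: eq_bigr => i _; rewrite ffunE.
  rewrite -(bigA_distr_bigA (fun i a => c (a, s i))).
  by apply: prodr_ile1 => i _; rewrite csum sumr_ge0.
rewrite (@le_trans _ _ (\sum_w (law P W w * - ln (law P (itinerary n Y) (sndn w)) +
   \sum_i law P W w * - ln (c (w i)))))//.
  apply: ler_sum => w _.
  have := law_ge0 P W w; rewrite le_eqVlt => /predU1P[<-|w0].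
    by rewrite !mul0r add0r big1// => i _; rewrite mul0r.
  have [l1 l2] := lnprod w (fun i => cpos _ (WZ w i w0)).
  rewrite /r lnM ?posrE ?Wpos// l1 opprD mulrDr lerD2l.
  by rewrite -sumrN mulr_sumr.
rewrite big_split/= lerD//.
  rewrite (law_expect P sndn (fun s => - ln (law P (itinerary n Y) s)))// /shannon -sumrN.
  by rewrite -sE; apply: ler_sum => s _; rewrite mulrN.
rewrite exchange_big/=.
rewrite (eq_bigr (fun=> cond_entropy P X Y)); last first.
  by move=> i _; exact: (sumr_itinerary_marginal (fun ab => - ln (c ab)) i mXY).
by rewrite sumr_const card_ord mulr_natl.
Qed.

Lemma entropy_rate_cond F G (X : T -> F) (Y : T -> G) :
  observable X -> observable Y ->
  entropy_rate X <= entropy_rate Y + cond_entropy P X Y.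
Proof.
move=> mX mY.
have cY := cvg_entropy_rate mY.
have cY' : (fun n => block_entropy Y n / n%:R + cond_entropy P X Y) @ \oo
   --> entropy_rate Y + cond_entropy P X Y by apply: cvgD => //; exact: cvg_cst.
rewrite -(cvg_lim _ cY')//; apply: limr_ge; first by apply/cvg_ex; eexists; exact: cY'.
near=> n.
have n0 : (0 < n)%N by near: n; exact: nbhs_infty_gt.
apply: (le_trans (entropy_rate_le mX n0)).
rewrite ler_pdivrMr ?ltr0n// mulrDl divfK ?pnatr_eq0 -?lt0n//.
by rewrite [X in _ + X]mulrC block_entropy_cond.
Unshelve. all: by end_near. Qed.

(** An n-block of m-blocks is a function of a single block of length n + m. *)
Lemma entropy_rate_itinerary F (X : T -> F) m : observable X ->
  entropy_rate (itinerary m X) <= entropy_rate X.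
Proof.
move=> mX; have mXm : observable (itinerary m X) by exact: observable_itinerary.
have cX := cvg_entropy_rate mX.
have cX' : (fun n => block_entropy X n / n%:R + block_entropy X m * n%:R^-1) @ \oo
    --> entropy_rate X.
  rewrite -[X in _ --> X]addr0; apply: cvgD => //.
  rewrite -[X in _ --> X](mulr0 (block_entropy X m)).
  by apply: cvgMr; exact: cvg_inv_nat.
rewrite -(cvg_lim _ cX')//; apply: limr_ge; first by apply/cvg_ex; eexists; exact: cX'.
near=> n.
have n0 : (0 < n)%N by near: n; exact: nbhs_infty_gt.
apply: (le_trans (entropy_rate_le mXm n0)).
rewrite -mulrDl ler_pM2r ?invr_gt0 ?ltr0n//.
apply: le_trans _ (block_entropyD n m mX).
pose h (w : {ffun 'I_(n + m) -> F}) : {ffun 'I_n -> {ffun 'I_m -> F}} :=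
  [ffun i : 'I_n => [ffun j : 'I_m => oapp w (X point) (insub (i + j)%N)]].
rewrite /block_entropy (_ : itinerary n (itinerary m X) = h \o itinerary (n + m) X).
  by apply: shannon_comp; exact: observable_itinerary.
apply/funext => x; apply/ffunP => i; apply/ffunP => j /=.
have ij : (i + j < n + m)%N by have := ltn_ord i; have := ltn_ord j; lia.
by rewrite !ffunE insubT /= ffunE -iterD addnC.
Unshelve. all: by end_near. Qed.

(** Refining a word [w] costs [kappa] per letter of [w] in [b]; by invariance
the expected number of such letters is n times their probability, and the
polynomial factor vanishes in the limit. The exponents 2 only reflect how the
bound arises in [refinements_bound]. *)
Lemma entropy_rate_card F G (X : T -> F) (h : F -> G) (b : pred G) (C kappa : R) :
  observable X -> 0 < C ->
  (forall n (w : {ffun 'I_n -> G}),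
     #|[pred u : {ffun 'I_n -> F} |
         ([ffun i => h (u i)] == w) && (0 < law P (itinerary n X) u)]|%:R
       <= (C * n.+1%:R ^+ 2) ^+ 2 * expR (kappa * #|[pred i | b (w i)]|%:R)) ->
  entropy_rate X <= entropy_rate (h \o X) + kappa * \sum_(a | b a) law P (h \o X) a.
Proof.
move=> mX C0 hc; have mhX : observable (h \o X) by exact: observable_comp.
set s := \sum_(a | b a) _.
apply/ler_addgt0Pr => e e0.
have [K hK] := ln_le_linear (divr_gt0 e0 (ltr0n R 4)).
pose K' := 2 * ln C + 4 * K.
have bound n : block_entropy X n <= block_entropy (h \o X) n +
    K' + (e + kappa * s) * n%:R.
  pose hn (u : {ffun 'I_n -> F}) : {ffun 'I_n -> G} := [ffun i => h (u i)].
  have mn : observable (itinerary n X) by exact: observable_itinerary.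
  have hE : hn \o itinerary n X = itinerary n (h \o X).
    by apply/funext => x; apply/ffunP => i; rewrite !ffunE.
  pose c (w : {ffun 'I_n -> G}) :=
    (C * n.+1%:R ^+ 2) ^+ 2 * expR (kappa * #|[pred i | b (w i)]|%:R).
  have cp : 0 < C * n.+1%:R ^+ 2 by rewrite mulr_gt0// exprn_gt0.
  have c0 w : 0 < c w by rewrite /c mulr_gt0 ?expR_gt0 ?exprn_gt0.
  apply: (le_trans (shannon_le_card mn (h := hn) (c := c) (hc n) c0)).
  rewrite hE -addrA lerD2l.
  apply: (@le_trans _ _ (\sum_w law P (itinerary n (h \o X)) w *
     (K' + e * n%:R + \sum_(i < n) kappa * (b (w i))%:R))).
    apply: ler_sum => w _; rewrite ler_wpM2l ?law_ge0//.
    rewrite /c lnM ?posrE ?expR_gt0 ?exprn_gt0// expRK lnXn// lnM ?posrE ?exprn_gt0// lnXn//.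
    rewrite -mulr_sumr (_ : \sum_(i < n) (b (w i))%:R = #|[pred i | b (w i)]|%:R); last first.
      rewrite -natr_sum -sum1_card [in RHS]big_mkcond/=.
      by congr (_%:R); apply: eq_bigr => i _; rewrite inE; case: (b _).
    rewrite lerD2r /K'; have := hK n; rewrite !mulr2n; lra.
  under eq_bigr do rewrite mulrDr mulr_sumr.
  rewrite big_split/= -mulr_suml law_sum1 ?mul1r; last exact: observable_itinerary.
  rewrite exchange_big/= (eq_bigr (fun=> kappa * s)).
    by rewrite sumr_const card_ord -[_ *+ n]mulr_natr; lra.
  move=> i _.
  rewrite (sumr_itinerary_marginal (fun a => kappa * (b a)%:R))//.
  rewrite /s mulr_sumr [RHS]big_mkcond/=; apply: eq_bigr => a _.
  by case: (b a); rewrite ?mulr1 ?mulr0// mulrC.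
have cX := cvg_entropy_rate mhX.
have cX' : (fun n => block_entropy (h \o X) n / n%:R + (K' * n%:R^-1 + (e + kappa * s))) @ \oo
    --> entropy_rate (h \o X) + (0 + (e + kappa * s)).
  apply: cvgD => //; apply: cvgD; last exact: cvg_cst.
  rewrite -[X in _ --> X](mulr0 K').
  by apply: cvgMr; exact: cvg_inv_nat.
rewrite -addrA [kappa * _ + e]addrC -[e + _]add0r.
rewrite -(cvg_lim _ cX')//; apply: limr_ge; first by apply/cvg_ex; eexists; exact: cX'.
near=> n.
have n0 : (0 < n)%N by near: n; exact: nbhs_infty_gt.
apply: (le_trans (entropy_rate_le mX n0)).
rewrite ler_pdivrMr ?ltr0n// addrA mulrDl mulrDl !divfK ?pnatr_eq0 -?lt0n//.
Unshelve. all: by end_near. Qed.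

Lemma partition_label k (Q : 'I_k -> set T) : measurable_partition Q ->
  exists2 X : T -> 'I_k, observable X & forall i, Q i = X @^-1` [set i].
Proof.
move=> [mQ tQ cQ].
have hX x : exists i, Q i x.
  have : setT x by []. by rewrite -cQ => -[i _ Qix]; exists i.
have [X QX] := choice hX.
have QE i : Q i = X @^-1` [set i].
  apply/seteqP; split => x /=; last by move=> <-.
  move=> Qix; apply/esym; have /(_ i (X x) I I) := tQ; apply.
  by exists x.
by exists X => // i; rewrite /observable -QE.
Qed.

Lemma partition_of_observable k (X : T -> 'I_k) : observable X ->
  measurable_partition (fun i => X @^-1` [set i]).
Proof.
move=> mX; split => //.
- by move=> i j _ _ [x [/= -> ->]].
- by apply/seteqP; split => // x _; exists (X x).
Qed.

Lemma join_cellE k (X : T -> 'I_k) n (w : {ffun 'I_n -> 'I_k}) :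
  join_cell f (fun i => X @^-1` [set i]) w = itinerary n X @^-1` [set w].
Proof.
apply/seteqP; split => x /=.
  by move=> h; apply/ffunP => i; rewrite ffunE; exact: h.
by move=> <- i _ /=; rewrite ffunE.
Qed.

Lemma join_entropyE k (X : T -> 'I_k) n :
  join_entropy f P (fun i => X @^-1` [set i]) n = block_entropy X n.
Proof.
rewrite /join_entropy /block_entropy /shannon; congr (- _); apply: eq_bigr => w _.
by rewrite join_cellE.
Qed.

Lemma partition_entropyE k (X : T -> 'I_k) : observable X ->
  partition_entropy f P (fun i => X @^-1` [set i]) = (entropy_rate X)%:E.
Proof.
move=> mX; apply: cvg_lim => //; apply: cvg_EFin; first by near=> n.
under eq_fun do rewrite join_entropyE.
exact: cvg_entropy_rate.
Unshelve. all: by end_near. Qed.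

Lemma le_ks_entropy k (X : T -> 'I_k) : observable X ->
  ((entropy_rate X)%:E <= ks_entropy f P)%E.
Proof.
move=> mX; apply: ereal_sup_ubound; exists k, (fun i => X @^-1` [set i]).
  exact: partition_of_observable.
by rewrite partition_entropyE.
Qed.

Lemma ks_entropy_le (h : \bar R) :
  (forall k (X : T -> 'I_k), observable X -> ((entropy_rate X)%:E <= h)%E) ->
  (ks_entropy f P <= h)%E.
Proof.
move=> H; apply: ge_ereal_sup => _ [k [Q mQ ->]].
have [X mX QE] := partition_label mQ.
have -> : Q = fun i => X @^-1` [set i] by apply/funext.
by rewrite partition_entropyE//; exact: H.
Qed.

End dynamics.

(** * Bounds on the size of sets *)

Section covered.
Context {R : realType}.
Implicit Types (N : R).

(** Cardinality bounds are expressed by covering lists, so that finiteness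
comes with the bound, and images, unions and products amount to the
corresponding operations on lists. *)
Definition covered (T : eqType) (S : set T) N :=
  exists2 s : seq T, (forall x, S x -> x \in s) & (size s)%:R <= N.

Lemma covered_le (T : eqType) (S S' : set T) N N' : S' `<=` S -> N <= N' ->
  covered S N -> covered S' N'.
Proof.
move=> SS NN [s sS sN]; exists s; last exact: le_trans sN NN.
by move=> x /SS /sS.
Qed.

Lemma covered_ge0 (T : eqType) (S : set T) N : covered S N -> 0 <= N.
Proof. by case=> s _; exact: le_trans. Qed.

Lemma covered_image (T T' : eqType) (f : T -> T') (S : set T) N :
  covered S N -> covered (f @` S) N.
Proof.
case=> s sS sN; exists (map f s); last by rewrite size_map.
by move=> _ [x Sx <-]; rewrite map_f// sS.
Qed.

Lemma covered_inj (T T' : eqType) (f : T -> T') (S : set T) (S' : set T') N :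
  {in S &, injective f} -> f @` S `<=` S' -> covered S' N -> covered S N.
Proof.
move=> fi fS [s sS sN].
pose g (y : T') : option T :=
  if pselect (exists x, S x /\ f x = y) is left e then Some (projT1 (cid e)) else None.
exists (pmap g s); last first.
  apply: le_trans sN; rewrite ler_nat size_pmap.
  exact: count_size.
move=> x Sx; rewrite mem_pmap; apply/mapP; exists (f x).
  by apply: sS; apply: fS; exists x.
rewrite /g; case: pselect => [e|]; last by case; exists x.
case: (cid e) => x' /= [Sx' fx']; congr Some.
by apply: fi; rewrite ?fx'//; exact: mem_set.
Qed.

Lemma covered_prod (T T' : eqType) (S : set T) (S' : set T') N N' :
  covered S N -> covered S' N' -> covered (S `*` S') (N * N').
Proof.
move=> [s sS sN] [s' sS' sN']; exists [seq (x, y) | x <- s, y <- s'].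
  by move=> [x y] [/= /sS xs /sS' ys]; rewrite allpairs_f.
by rewrite size_allpairs natrM ler_pM.
Qed.

Lemma coveredU (T : eqType) (S S' : set T) N N' :
  covered S N -> covered S' N' -> covered (S `|` S') (N + N').
Proof.
move=> [s sS sN] [s' sS' sN']; exists (s ++ s').
  by move=> x [/sS xs|/sS' xs]; rewrite mem_cat xs ?orbT.
by rewrite size_cat natrD lerD.
Qed.

Lemma covered_bigcup (T : eqType) k (S : nat -> set T) (N : nat -> R) :
  (forall i, (i < k)%N -> covered (S i) (N i)) ->
  covered (\bigcup_(i < k) S i) (\sum_(i < k) N i).
Proof.
elim: k => [_|k IH h].
  by rewrite big_ord0; exists [::]; [move=> x [i /=]; rewrite ltn0|exact: lexx].
rewrite big_ord_recr/=.
have := coveredU (IH (fun i ik => h i (ltnW ik))) (h k (ltnSn k)).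
apply: covered_le => // x [i /= ik Six].
have [E|ki] := eqVneq i k; first by right; rewrite -E.
by left; exists i => //=; lia.
Qed.

Lemma covered_counting (T : choiceType) (S : set T) N :
  (counting S <= N%:E)%E -> covered S N.
Proof.
rewrite /counting; case: asboolP => // fS; rewrite lee_fin => SN.
exists (fset_set S : seq T) => // x Sx.
by have : x \in fset_set S by rewrite in_fset_set//; exact: mem_set.
Qed.

Lemma counting_ge1 (T : choiceType) (S : set T) : S !=set0 ->
  (1 <= counting S :> \bar R)%E.
Proof.
move=> [x Sx]; rewrite /counting; case: asboolP => [fS|_]; last by rewrite leey.
rewrite lee_fin ler1n cardfs_gt0; apply/eqP => S0.
have : x \in fset_set S by rewrite in_fset_set//; exact: mem_set.
by rewrite S0 in_fset0.
Qed.

(** The finitely many lengths below [l1] are absorbed by the constant, since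
[expR (kappa * l)] is at least 1. *)
Lemma covered_unif (T : eqType) (S : nat -> set T) (K kappa : R) l1 :
  0 <= kappa -> (forall l, exists N : R, covered (S l) N) ->
  (forall l, (l1 <= l)%N -> covered (S l) (K * expR (kappa * l%:R))) ->
  exists C, forall l, covered (S l) (C * expR (kappa * l%:R)).
Proof.
move=> k0 hfin h; have {hfin}[N hN] := choice hfin.
exists (`|K| + \sum_(i < l1) N i) => l.
have e1 : 1 <= expR (kappa * l%:R) by rewrite -expR0 ler_expR mulr_ge0.
have e0 : 0 <= expR (kappa * l%:R) by exact: expR_ge0.
have s0 : 0 <= \sum_(i < l1) N i.
  by rewrite sumr_ge0// => i _; exact: covered_ge0 (hN i).
have [/h hl|ll1] := leqP l1 l.
  apply: covered_le hl => //; rewrite ler_wpM2r//.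
  by apply: (le_trans (ler_norm K)); rewrite lerDl.
apply: covered_le (hN l) => //.
apply: (@le_trans _ _ (\sum_(i < l1) N i)).
  rewrite (bigD1 (Ordinal ll1))//= lerDl sumr_ge0// => i _.
  exact: covered_ge0 (hN i).
apply: (@le_trans _ _ (`|K| + \sum_(i < l1) N i)); first by rewrite lerDr.
by rewrite ler_peMr// addr_ge0.
Qed.

Lemma card_covered (F : finType) (T : eqType) (D : pred F)
    (f : F -> T) (S : set T) N :
  injective f -> (forall u, D u -> S (f u)) -> covered S N -> #|D|%:R <= N.
Proof.
move=> fi fS [s sS sN]; apply: le_trans sN; rewrite ler_nat cardE -(size_map f).
apply: uniq_leq_size; first by rewrite map_inj_uniq// enum_uniq.
by move=> _ /mapP[u + ->]; rewrite mem_enum => Du; apply/sS/fS.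
Qed.

End covered.

(** * Upper and lower limits, growth rates *)

Section limits.
Context {R : realType}.
Implicit Types (u : nat -> \bar R) (c : \bar R).

Local Open Scope ereal_scope.

Lemma limn_esup_lt u c : limn_esup u < c ->
  exists n0, forall n, (n0 <= n)%N -> u n < c.
Proof.
move=> /ereal_inf_lt[_ [V [n0 _ hV] <-] h]; exists n0 => n /hV Vn.
by apply: le_lt_trans h; apply: ereal_sup_ubound; exists n.
Qed.

Lemma limn_esup_le_near u c : (\forall n \near \oo, u n <= c) -> limn_esup u <= c.
Proof.
move=> h; apply: (@le_trans _ _ (ereal_sup (u @` [set n | u n <= c]))).
  by apply: ereal_inf_lbound; exists [set n | u n <= c].
by apply: ge_ereal_sup => _ [n /= unc <-].
Qed.

Lemma limn_esup_ge u c : (forall n0, exists2 n, (n0 <= n)%N & c <= u n) ->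
  c <= limn_esup u.
Proof.
move=> h; apply: le_ereal_inf_tmp => _ [V [n0 _ hV] <-].
have [n /hV Vn cu] := h n0.
by apply: (le_trans cu); apply: ereal_sup_ubound; exists n.
Qed.

Lemma limn_einf_ge u c : (\forall n \near \oo, c <= u n) -> c <= limn_einf u.
Proof.
move=> h; rewrite /limn_einf leeNr; apply: limn_esup_le_near.
by near=> n; rewrite leeN2; near: n.
Unshelve. all: by end_near. Qed.

Lemma limn_einf_lt u c n0 : limn_einf u < c -> exists2 n, (n0 <= n)%N & u n < c.
Proof.
move=> h; apply: contrapT => hn; move: h; apply/negP; rewrite -leNgt.
apply: limn_einf_ge; exists n0 => // n /= n0n.
by rewrite leNgt; apply/negP => unc; apply: hn; exists n.
Qed.

Lemma growth_rate_lt (c : nat -> \bar R) (kappa : R) :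
  growth_rate c < kappa%:E ->
  exists n0, forall n, (n0 <= n)%N -> c n <= (expR (kappa * n%:R))%:E.
Proof.
move=> /limn_esup_lt[n0 h]; exists n0.+1 => n n0n.
have n0' : (0 < n%:R :> R)%R by rewrite ltr0n; lia.
have := h n (ltnW n0n); case: (c n) => [r| |] //=; last 2 first.
- by rewrite gt0_muley// lte_fin invr_gt0.
- by rewrite leNye.
case: ifPn => [r0 _|]; first by rewrite lee_fin (le_trans r0)// expR_ge0.
rewrite -ltNge => r0; rewrite -EFinM lte_fin mulrC ltr_pdivrMr// lee_fin => hr.
by rewrite -[leLHS]lnK ?posrE// ler_expR ltW.
Qed.

Lemma growth_rate_ge0 (c : nat -> \bar R) :
  (forall n0, exists2 n, (n0 <= n)%N & 1 <= c n) -> 0 <= growth_rate c.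
Proof.
move=> h; apply: limn_esup_ge => n0; have [n n0n cn] := h n0.
by exists n => //; rewrite mule_ge0 ?lne_ge0// lee_fin.
Qed.

End limits.

(** * Splitting words *)

Lemma count_predC0 (p : pred nat) s : all (predC p) s -> count p s = 0%N.
Proof. by rewrite all_predC has_count -eqn0Ngt => /eqP. Qed.

Lemma split_first (p : pred nat) s : has p s ->
  exists s1 x s2, [/\ s = s1 ++ x :: s2, p x & all (predC p) s1].
Proof.
elim: s => [//|y s IH] /=; have [py _|npy /= /IH] := boolP (p y).
  by exists [::], y, s.
by move=> [s1 [x [s2 [-> px a1]]]]; exists (y :: s1), x, s2; rewrite /= npy.
Qed.

Lemma split_last (p : pred nat) s : has p s ->
  exists s1 x s2, [/\ s = s1 ++ x :: s2, p x & all (predC p) s2].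
Proof.
elim: s => [//|y s IH] /=.
have [/IH [s1 [x [s2 [-> px a1]]]] _|hs] := boolP (has p s).
  by exists (y :: s1), x, s2.
rewrite orbF => py; exists [::], y, s; split => //.
by rewrite all_predC.
Qed.

(** * Paths in the graph of a countable Markov shift *)

Section paths.
Variables (A : rel nat) (tA : cms_transitive A).

(** Paths of [l] steps from [b] to [c], listed without their first vertex, so
that concatenation of lists is composition of paths. *)
Definition walk (b c l : nat) : set (seq nat) :=
  [set t | [/\ size t = l, path A b t & last b t = c]].

Lemma walk_cat b c d l l' t t' : walk b c l t -> walk c d l' t' ->
  walk b d (l + l') (t ++ t').
Proof.
move=> [<- pt lt] [<- pt' lt']; split; first by rewrite size_cat.
  by rewrite cat_path pt lt.
by rewrite last_cat lt.
Qed.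

(** Leaving [b] for a different vertex takes at least one step, so that inserting
detours makes a path as long as desired. *)
Lemma walk_long b c k : exists l t, walk b c l t /\ (k <= l)%N.
Proof.
elim: k b => [|k IH] b.
  by have [t pt lt] := tA b c; exists (size t), t; split.
have [l [t [ct kl]]] := IH b.+1.
have [s ps ls] := tA b b.+1.
exists (size s + l)%N, (s ++ t); split; first exact: (walk_cat (And3 erefl ps ls)).
case: s ps ls => [|a s] _ //=; last by rewrite addSn ltnS (leq_trans kl)// leq_addl.
by move/n_Sn.
Qed.

Lemma periodic_point_subproof a t : (0 < size t)%N -> path A a t -> last a t = a ->
  (fun i => nth 0%N (a :: t) (i %% size t)) \in cms_set A.
Proof.
move=> t0 pt lt; apply/mem_set => i /=.
have im : (i %% size t < size t)%N by rewrite ltn_pmod.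
have := pathP 0%N pt _ im.
have [E|E] := eqVneq (i %% size t).+1 (size t).
  have -> : (i.+1 %% size t = 0)%N.
    by rewrite -addn1 -modnDml addn1 E modnn.
  have -> : nth 0%N t (i %% size t) = a by rewrite -[RHS]lt (last_nth 0%N) -[in RHS]E.
  by [].
have -> : (i.+1 %% size t = (i %% size t).+1)%N.
  by rewrite -addn1 -modnDml addn1 modn_small//; lia.
by [].
Qed.

(** Distinct loops of length [l] at [a], repeated periodically, are distinct
periodic points. *)
Lemma covered_loops (R : realType) a l (N : R) : (0 < l)%N ->
  covered (periodic_points tA a l) N -> covered (walk a a l) N.
Proof.
move=> l0.
pose f t : cms tA :=
  if pselect [/\ (0 < size t)%N, path A a t & last a t = a] is left h then
    let: And3 h1 h2 h3 := h in
    exist (fun x => x \in cms_set A) _ (periodic_point_subproof h1 h2 h3)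
  else point.
have fE t i : walk a a l t -> set_val (f t) i = nth 0%N (a :: t) (i %% l).
  move=> [st pt lt]; rewrite /f; case: pselect => [[h1 h2 h3]|]; first by rewrite -st.
  by case; rewrite st.
apply: (@covered_inj _ _ _ f).
  move=> t t' /set_mem ht /set_mem ht' E.
  have [st pt lt] := ht. have [st' pt' lt'] := ht'.
  apply: (@eq_from_nth _ 0%N) => [|i]; rewrite st ?st'// => il.
  have [E1|E1] := eqVneq i.+1 l.
    move: (lt) (lt'); rewrite !(last_nth 0%N) st st' -E1 /= => -> ->; done.
  have := fE t i.+1 ht; rewrite E (fE t' i.+1 ht') modn_small//=; lia.
move=> _ [t ht <-]; split; last by rewrite fE// mod0n.
apply/val_inj/funext => i /=.
have shE (x : cms tA) j : set_val (@cms_shift A tA x) j = set_val x j.+1 by [].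
have iterE n (x : cms tA) j : set_val (iter n (@cms_shift A tA) x) j = set_val x (j + n)%N.
  elim: n j => [|n IH] j; first by rewrite addn0.
  by rewrite iterS shE IH addSnnS.
have := iterE l (f t) i; rewrite (fE t _ ht) modnDr -(fE t _ ht).
by [].
Qed.

(** Extending paths by fixed paths at both ends is injective. *)
Lemma covered_walk_extend (R : realType) b' b c c' lp l lr p r (N : R) :
  walk b' b lp p -> walk c c' lr r ->
  covered (walk b' c' (lp + l + lr)) N -> covered (walk b c l) N.
Proof.
move=> cp cr; apply: (@covered_inj _ _ _ (fun t => p ++ t ++ r)).
  move=> t t' /set_mem[st _ _] /set_mem[st' _ _] /eqP.
  by rewrite eqseq_cat// eqxx/= eqseq_cat ?st ?st'// => /andP[/eqP].
move=> _ [t ct <-]; rewrite -addnA.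
exact: (walk_cat cp (walk_cat ct cr)).
Qed.

(** The constant in front of the exponential is 1, because a word may contain many
excursions and each of them contributes one such factor; this is why only
lengths from some point on are considered. *)
Definition escaping_bound (R : realType) M q (kappa : R) := exists n0, forall n,
  (n0 <= n)%N -> covered (escaping_words A M q n) (expR (kappa * n%:R)).

(** By transitivity every vertex has a successor, so that an admissible word
extends to an infinite one. *)
Lemma cylinder_nonempty w : (0 < size w)%N -> sorted A w -> cylinder tA w !=set0.
Proof.
case: w => [//|b t] _ /= pt.
pose succ c := xchoose (cms_transitive_succ tA c).
have succP c : A c (succ c) by exact: (xchooseP (cms_transitive_succ tA c)).
pose x i := if (i <= size t)%N then nth 0%N (b :: t) i
            else iter (i - size t) succ (last b t).
have xA : x \in cms_set A.
  apply/mem_set => i; rewrite /x; have [ilt|] := ltnP i (size t).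
    by rewrite (ltnW ilt); exact: (pathP 0%N pt i ilt).
  rewrite leq_eqVlt => /predU1P[ti|ti].
    by rewrite -ti leqnn subSnn -(last_nth 0%N).
  by rewrite leqNgt ti /= subSn ?iterS//; exact: ltnW.
exists (exist (fun y => y \in cms_set A) x xA) => i /= il.
by change (x i = nth 0%N (b :: t) i); rewrite /x; case: ifP => //; lia.
Qed.

Lemma cylinder_inj n :
  {in [set w : seq nat | size w = n.+1 /\ sorted A w] &, injective (cylinder tA)}.
Proof.
move=> w w' /set_mem[sw pw] /set_mem[sw' pw'] E.
have [x wx] : cylinder tA w !=set0 by apply: cylinder_nonempty => //; rewrite sw.
have w'x : cylinder tA w' x by rewrite -E.
apply: (@eq_from_nth _ 0%N) => [|i]; rewrite sw ?sw'// => il.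
by rewrite -wx ?sw// w'x// sw'.
Qed.

(** Distinct admissible words of the same length have distinct cylinders, since
cylinders are nonempty. *)
Lemma escaping_bound_delta (R : realType) M q (kappa : R) :
  (delta_infty_Mq R tA M q < kappa%:E)%E -> escaping_bound M q kappa.
Proof.
move=> /growth_rate_lt[n0 h]; exists n0 => n /h /covered_counting.
apply: (@covered_inj _ _ _ (cylinder tA)) => //.
move=> w w' /set_mem[sw pw _ _ _] /set_mem[sw' pw' _ _ _].
by apply: (@cylinder_inj n.+1); exact: mem_set.
Qed.

Section finite_entropy.
Context {R : realType}.
Variables (a : nat) (htop : (gurevich_entropy R tA a < +oo)%E).

Lemma loops_bound : exists H : R, exists n0, [/\ 0 <= H &
  forall l, (n0 <= l)%N -> covered (walk a a l) (expR (H * l%:R))].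
Proof.
have [H [H0 hH]] : exists H : R, 0 <= H /\ (gurevich_entropy R tA a < H%:E)%E.
  case: (gurevich_entropy R tA a) htop => [r _| |] //.
    by exists (`|r| + 1); rewrite addr_ge0// lte_fin; split => //; have := ler_norm r; lra.
  by exists 0; rewrite ltNyr.
have [n0 h] := growth_rate_lt hH; exists H, n0.+1; split => // l ln.
apply: covered_loops; first by lia.
by apply: covered_counting; apply: h; lia.
Qed.

(** The path is closed up to a loop at [a] long enough for the eventual bound on
periodic points to apply. *)
Lemma covered_walk b c l : exists N : R, covered (walk b c l) N.
Proof.
have [H [n0 [_ h]]] := loops_bound.
have [lp [p [cp _]]] := walk_long a b 0.
have [lr [r [cr lrn]]] := walk_long c a n0.
exists (expR (H * (lp + l + lr)%:R)).
by apply: (covered_walk_extend cp cr); apply: h; lia.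
Qed.

Lemma walk_growth : exists H : R, 0 <= H /\ forall b c, exists (K : R) n0,
  forall l, (n0 <= l)%N -> covered (walk b c l) (K * expR (H * l%:R)).
Proof.
have [H [n0 [H0 h]]] := loops_bound; exists H; split => // b c.
have [lp [p [cp _]]] := walk_long a b 0.
have [lr [r [cr lrn]]] := walk_long c a 0.
exists (expR (H * (lp + lr)%:R)), n0 => l ln.
apply: (covered_walk_extend cp cr).
apply: covered_le (h (lp + l + lr)%N _) => //; last by lia.
by rewrite -expRD ler_expR -mulrDr -natrD addnAC.
Qed.

Lemma escaping_words_walk M q n : escaping_words A M q n `<=`
  \bigcup_(b < q) \bigcup_(c < q) (cons b @` walk b c n.+1).
Proof.
move=> [|b t] [//= [st] pt bq cq _]; exists b => //; exists (nth 0%N t n) => //.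
exists t => //; split => //.
by rewrite (last_nth 0%N) st.
Qed.

(** For [M = 0] there is no restriction on the number of visits, and the growth
rate is at most the topological entropy. The point is that [H] does not depend
on [q]. *)
Lemma escaping_bound_entropy : exists H : R, 0 <= H /\ forall q, escaping_bound 0 q H.
Proof.
have [H [H0 h]] := walk_growth.
exists (H + 1); split => [|q]; first by rewrite addr_ge0.
have {h} h bc : exists Kn : R * nat, forall l, (Kn.2 <= l)%N ->
    covered (walk bc.1 bc.2 l) (Kn.1 * expR (H * l%:R)).
  by have [K [n0 h']] := h bc.1 bc.2; exists (K, n0).
have {h}[K h] := choice h.
pose KK := \sum_(b < q) \sum_(c < q) (K (b : nat, c : nat)).1 * expR H.
have [n1 hn1] := expR_dominates KK.
pose n2 := \max_(b < q) \max_(c < q) (K (b : nat, c : nat)).2.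
exists (maxn n1 n2) => n; rewrite geq_max => /andP[n1n n2n].
apply: (@covered_le _ _ _ _ (\sum_(b < q) \sum_(c < q)
    (K (b : nat, c : nat)).1 * expR (H * n.+1%:R))
    _ (@escaping_words_walk _ _ _)); last first.
  apply: (covered_bigcup (N := fun b => \sum_(c < q) (K (b, c : nat)).1 * expR (H * n.+1%:R))) => b bq.
  apply: (covered_bigcup (N := fun c => (K (b, c)).1 * expR (H * n.+1%:R))) => c cq.
  apply: covered_image; apply: (h (b, c)).
  apply: leq_trans (leqW n2n).
  rewrite /n2 (bigD1 (Ordinal bq))//= (bigD1 (Ordinal cq))//=.
  by rewrite -maxnA leq_maxl.
rewrite (_ : \sum_(b < q) _ = KK * expR (H * n%:R)).
  by rewrite mulrDl mul1r expRD mulrC ler_wpM2l ?expR_ge0// hn1.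
rewrite /KK mulr_suml; apply: eq_bigr => b _; rewrite mulr_suml; apply: eq_bigr => c _.
by rewrite -mulrA -expRD -natr1 mulrDr mulr1 addrC.
Qed.

(** Finitely many paths use finitely many letters. *)
Lemma letters_bounded q L : exists m0, forall b c l t, (b < q)%N -> (c < q)%N ->
  (l <= L)%N -> walk b c l t -> all (fun k => (k < m0)%N) t.
Proof.
have h bcl : exists N : R, covered (walk bcl.1.1 bcl.1.2 bcl.2) N.
  exact: covered_walk.
have {h}[N h] := choice h.
have [s hs _] : covered (\bigcup_(b < q) \bigcup_(c < q) \bigcup_(l < L.+1) walk b c l)
    (\sum_(b < q) \sum_(c < q) \sum_(l < L.+1) N (b : nat, c : nat, l : nat)).
  apply: (covered_bigcup (N := fun b => \sum_(c < q) \sum_(l < L.+1) N (b, c : nat, l : nat))) => b bq.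
  apply: (covered_bigcup (N := fun c => \sum_(l < L.+1) N (b, c, l : nat))) => c cq.
  apply: (covered_bigcup (N := fun l => N (b, c, l))) => l lL.
  exact: (h (b, c, l)).
(* One more than the largest letter in the covering list. *)
exists (\max_(t <- s) \max_(k <- t) k).+1 => b c l t bq cq lL ct.
apply/allP => k kt; rewrite ltnS.
have ts : t \in s by apply: hs; exists b => //; exists c => //; exists l.
apply: leq_trans (leq_bigmax_seq (F := fun t => \max_(k <- t) k) _ ts _) => //.
exact: (leq_bigmax_seq (F := id) _ kt).
Qed.

(** Paths of length at most [n0 + 1] between letters [< q] only use letters
[< m0]. A closed path through 0 and a vertex [v >= m0] contains an excursion
through [v], which is therefore longer. *)
Lemma excursion_exists q n0 : (0 < q)%N -> exists n b c t,
  [/\ (n0 <= n)%N, walk b c n.+1 t, (b < q)%N, (c < q)%N &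
   count (fun k => (k < q)%N) (b :: t) = 2%N].
Proof.
move=> q0; have [m0 h] := letters_bounded q n0.+1.
(* Below, z1 is the part of the path from 0 to v after its last letter < q, and
   z2 the part of the path back to 0 before its first letter < q. *)
pose v := maxn m0 q.
have [t1 p1 l1] := tA 0%N v. have [t2 p2 l2] := tA v 0%N.
have [s1 [b [z1 [E1 bq az1]]]] : exists s1 x s2, [/\ 0%N :: t1 = s1 ++ x :: s2,
    (x < q)%N & all (predC (fun k => (k < q)%N)) s2].
  by apply: split_last; rewrite /= q0.
have vq : (v < q)%N = false by rewrite /v; lia.
have [z2 [c [s3 [E2 cq az2]]]] : exists s1 x s2, [/\ t2 = s1 ++ x :: s2,
    (x < q)%N & all (predC (fun k => (k < q)%N)) s1].
  apply: split_first; apply/hasP; exists 0%N => //.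
  case: t2 l2 {p2} => [/= l2|x t2 <-]; last exact: mem_last.
  by rewrite l2 q0 in vq.
have lv : last b z1 = v.
  by rewrite -l1 -[RHS]/(last 0%N (0%N :: t1)) E1 last_cat.
have vz1 : v \in z1.
  case: z1 lv {E1 az1} => [/= E|x z1 <-]; last exact: mem_last.
  by rewrite E vq in bq.
have pz1 : path A b z1.
  have : sorted A (0%N :: t1) by [].
  by rewrite E1 => /cat_sorted2[].
have pz2 : path A v (rcons z2 c).
  by move: p2; rewrite E2 -cat_rcons cat_path => /andP[].
pose t := z1 ++ rcons z2 c.
have ct : walk b c (size t) t.
  split => //; first by rewrite cat_path pz1 lv.
  by rewrite /t last_cat last_rcons.
have st : (n0.+1 < size t)%N.
  rewrite ltnNge; apply/negP => tn.
  have /allP/(_ v) := h b c _ t bq cq tn ct.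
  by rewrite mem_cat vz1 => /(_ isT); rewrite /v; lia.
exists (size t).-1, b, c, t; split => //; first by lia.
- by rewrite prednK//; lia.
- rewrite /t /= count_cat -cats1 count_cat /= bq cq.
  by rewrite !count_predC0.
Qed.

(** An excursion visits the letters [< q] exactly twice, so that long ones are
escaping words for every [M]. *)
Lemma delta_infty_Mq_ge0 M q : (0 < q)%N -> (0 <= delta_infty_Mq R tA M q)%E.
Proof.
move=> q0; apply: growth_rate_ge0 => n0.
have [n [b [c [t [nn ct bq cq cnt]]]]] := excursion_exists (maxn n0 (2 * M)) q0.
exists n; first by lia.
apply: counting_ge1; exists (cylinder tA (b :: t)), (b :: t) => //.
have [st pt lt] := ct; split => //=; first by rewrite st.
- by move: cq; rewrite -lt (last_nth 0%N) st.
- move: cnt => /= ->; lia.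
Qed.

End finite_entropy.

End paths.

(** * Counting the refinements of a truncated word *)

Section refining.
Context {R : realType}.
Variables (A : rel nat) (tA : cms_transitive A).
Hypothesis walk_fin : forall b c l, exists N : R, covered (walk A b c l) N.
Variables (q M : nat) (kappa : R).
Hypotheses (q0 : (0 < q)%N) (k0 : 0 <= kappa) (hB : escaping_bound A M q kappa).

Let low k := (k < q)%N.

Let high k := (q <= k)%N.

(** Fixed connecting paths to the letter 0 turn a path with at most one visit to
the letters [< q] into one with boundedly many visits; when the path is long
these are few enough for an escaping word. *)
Lemma few_visits_walk b c : exists C : R, forall l,
  covered [set t | walk A b c l t /\ (count low (b :: t) <= 1)%N]
    (C * expR (kappa * l%:R)).
Proof.
have [lp [p [cp _]]] := walk_long tA 0%N b 0.
have [lr [r [cr _]]] := walk_long tA c 0%N 0.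
have [n0 h] := hB.
apply: (@covered_unif _ _ _ (expR (kappa * (lp + lr)%:R)) _ (n0 + (lp + lr + 2) * M).+2) => //.
  move=> l; have [N hN] := walk_fin b c l; exists N.
  by apply: covered_le hN => // t [].
move=> l ll; rewrite -expRD -mulrDr -natrD.
have [n En] : exists n, (lp + lr + l = n.+1)%N by exists (lp + lr + l).-1; lia.
have ll' : (n0.+2 <= l)%N by apply: leq_trans ll; rewrite !ltnS leq_addr.
have ll2 : ((lp + lr + 2) * M <= l)%N.
  by apply: leq_trans ll; rewrite !leqW// leq_addl.
clear ll; have n0n : (n0 <= n)%N by lia.
apply: (@covered_inj _ _ _ (fun t => 0%N :: p ++ t ++ r) _ (escaping_words A M q n)).
- move=> t t' /set_mem[[st _ _] _] /set_mem[[st' _ _] _] [] /eqP.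
  by rewrite eqseq_cat// eqxx/= eqseq_cat ?st ?st'// => /andP[/eqP].
- move=> _ [t [ct cnt] <-].
  have [s1 p1 l1] := walk_cat cp (walk_cat ct cr).
  have s1' : size (p ++ t ++ r) = n.+1 by rewrite s1; lia.
  split => //=; first by rewrite s1'.
  + by move: l1; rewrite (last_nth 0%N) s1' /= => ->.
  + move: cnt; rewrite !count_cat /= /low.
    have [spp _ _] := cp. have [spr _ _] := cr.
    have := count_size low p. have := count_size low r. rewrite /low spp spr.
    have : (0 < q)%N by []. nia.
- apply: covered_le (h n n0n) => //; rewrite ler_expR ler_wpM2l// ler_nat; lia.
Qed.

Definition few_visits m l : set (seq nat) := [set y | exists b t,
  [/\ y = b :: t, size y = l, path A b t, (b < m)%N /\ (last b t < m)%N &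
      (count low y <= 1)%N]].

Lemma few_visits_bound m : exists C : R, 0 <= C /\ forall l,
  covered (few_visits m l) (C * expR (kappa * l%:R)).
Proof.
have h (bc : nat * nat) := few_visits_walk bc.1 bc.2.
have {h}[C h] := choice h.
have C0 bc : 0 <= C bc.
  by have := covered_ge0 (h bc 0%N); rewrite mulr0 expR0 mulr1.
exists (\sum_(b < m) \sum_(c < m) C (b : nat, c : nat)); split.
  by rewrite sumr_ge0// => b _; rewrite sumr_ge0.
move=> l; rewrite mulr_suml.
under eq_bigr do rewrite mulr_suml.
pose S b c := cons b @` [set t | walk A b c l.-1 t /\ (count low (b :: t) <= 1)%N].
have : covered (\bigcup_(b < m) \bigcup_(c < m) S b c)
    (\sum_(b < m) \sum_(c < m) C (b : nat, c : nat) * expR (kappa * l%:R)).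
  apply: (covered_bigcup (N := fun b => \sum_(c < m) C (b, c : nat) * expR (kappa * l%:R))) => b bm.
  apply: (covered_bigcup (N := fun c => C (b, c) * expR (kappa * l%:R))) => c cm.
  apply: covered_image; apply: covered_le (h (b, c) l.-1) => //.
  by rewrite ler_wpM2l// ler_expR ler_wpM2l// ler_nat leq_pred.
apply: covered_le => // _ [b [t [-> st pt [bm lm] cnt]]].
exists b => //; exists (last b t) => //; exists t => //; split => //; split => //.
by rewrite -st.
Qed.

Variables (m0 n1 : nat).
Hypothesis qm0 : (q <= m0)%N.
Hypothesis short_letters : forall b c l t, (b < q)%N -> (c < q)%N ->
  (l <= n1)%N -> walk A b c l t -> all (fun k => (k < m0)%N) t.
Hypothesis n1M : (2 * M <= n1)%N.
Hypothesis n1E : forall n, (n1 <= n.+1)%N ->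
  covered (escaping_words A M q n) (expR (kappa * n%:R)).
Variable m : nat.
Hypothesis m0m : (m0 <= m)%N.

Definition refinements (w : seq nat) : set (seq nat) :=
  [set map (minn m) y | y in [set y | sorted A y /\ map (minn m0) y = w]].

Lemma low_minn k : low (minn m0 k) = low k.
Proof. by rewrite /low; lia. Qed.

Lemma count_low_minn y : count low (map (minn m0) y) = count low y.
Proof. by rewrite count_map; apply: eq_count => k; exact: low_minn. Qed.

Lemma count_low0 v : all high v -> count low v = 0%N.
Proof.
by move=> av; apply: count_predC0; apply: sub_all av => k; rewrite /high /low /= -leqNgt.
Qed.

(** A refinement of the whole is determined by its restrictions to two pieces
that overlap in [a]. *)
Lemma refinements_split w1 a w2 (N1 N2 : R) : covered (refinements (rcons w1 a)) N1 ->
  covered (refinements (a :: w2)) N2 -> covered (refinements (w1 ++ a :: w2)) (N1 * N2).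
Proof.
move=> h1 h2.
apply: (covered_inj (f := fun u => (take (size w1).+1 u, drop (size w1) u)) _ _
  (covered_prod h1 h2)).
  move=> u u' _ _ [E1 E2].
  rewrite -(cat_take_drop (size w1) u) -(cat_take_drop (size w1) u') E2.
  congr (_ ++ _).
  have := congr1 (take (size w1)) E1.
  by rewrite !take_takel.
move=> _ [_ [y [py Ey] <-] <-]; split => /=.
  exists (take (size w1).+1 y); last by rewrite map_take.
  split; first exact: take_sorted.
  by rewrite map_take Ey -cat_rcons -(size_rcons w1 a) take_size_cat.
exists (drop (size w1) y); last by rewrite map_drop.
by split; [exact: drop_sorted|rewrite map_drop Ey drop_size_cat].
Qed.

(** A short excursion only uses letters [< m0], so that the truncated word is the
word itself; a long one is an escaping word. *)
Lemma refinements_excursion a w b : low a -> low b -> all high w ->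
  covered (refinements (a :: rcons w b)) (expR (kappa * (count high w)%:R)).
Proof.
move=> la lb hw; rewrite (_ : count high w = size w); last by apply/eqP; rewrite -all_count.
have Y y : sorted A y -> map (minn m0) y = a :: rcons w b -> exists b0 t,
    y = b0 :: t /\ [/\ walk A b0 (last b0 t) (size w).+1 t, low b0, low (last b0 t) &
      count low y = 2%N].
  case: y => // b0 t pt E; exists b0, t; split => //.
  have st : size t = (size w).+1.
    by have := congr1 size E; rewrite /= size_map size_rcons => -[].
  split => //.
  - by rewrite -low_minn; case: E => ->.
  - rewrite -low_minn -(last_map (minn m0)); case: E => -> ->.
    by rewrite last_rcons.
  - rewrite -count_low_minn E /= la -cats1 count_cat /= lb.
    by rewrite count_low0.
have [wn|wn] := leqP (size w).+1 n1.
  exists [:: map (minn m) (a :: rcons w b)]; last first.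
    by rewrite /= -expR0 ler_expR mulr_ge0.
  move=> _ [y [py Ey] <-]; rewrite inE; apply/eqP; congr map.
  have [b0 [t [yE [ct lb0 lt _]]]] := Y y py Ey.
  have := short_letters lb0 lt wn ct => at0.
  rewrite -Ey -[LHS]map_id; apply/eq_in_map => k.
  rewrite yE in_cons => /predU1P[->|/(allP at0)]; first by move: lb0; rewrite /low; lia.
  by lia.
apply: (covered_le _ _ (covered_image (map (minn m)) (n1E (n := size w) _))) => //.
  apply: image_subset => y [py Ey].
  have [b0 [t [yE [ct lb0 lt cnt]]]] := Y y py Ey.
  have [st pt _] := ct; split => //; rewrite ?yE//=; first by rewrite st.
    by move: lt; rewrite (last_nth 0%N) st.
  by move: cnt; rewrite yE /= /low => ->; lia.
by lia.
Qed.

(** A refinement is a run of the symbol [m], or a run of [m], the truncation of a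
word in [few_visits m] and another run of [m]. The lengths [i] and [j] of the
two outer runs account for the quadratic factor. *)
Lemma refinements_few_visits_aux : exists C : R, 0 <= C /\ forall w, (count low w <= 1)%N ->
  covered (refinements w) (1 + C * (size w).+1%:R ^+ 2 * expR (kappa * (size w)%:R)).
Proof.
have [C [C0 h]] := few_visits_bound m; exists C; split => // w cw.
set n := size w.
pose S i j := (fun y => nseq i m ++ map (minn m) y ++ nseq j m) @` few_visits m (n - i - j).
have : covered ([set nseq n m] `|` \bigcup_(i < n.+1) \bigcup_(j < n.+1) S i j)
    (1 + \sum_(i < n.+1) \sum_(j < n.+1) C * expR (kappa * n%:R)).
  apply: coveredU; first by exists [:: nseq n m] => // x ->; rewrite mem_seq1.
  apply: (covered_bigcup (N := fun=> \sum_(j < n.+1) C * expR (kappa * n%:R))) => i _.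
  apply: (covered_bigcup (N := fun=> C * expR (kappa * n%:R))) => j _.
  apply: covered_image; apply: covered_le (h (n - i - j)%N) => //.
  rewrite ler_wpM2l// ler_expR ler_wpM2l// ler_nat; lia.
apply: covered_le; last first.
  rewrite !sumr_const !card_ord lerD2l -mulrnA -[X in X <= _]mulr_natr natrM.
  by apply: eq_ler; rewrite /n; ring.
move=> _ [y [py Ey] <-].
have sy : size y = n by rewrite /n -Ey size_map.
pose p k := (k < m)%N.
have nseqE s : all (predC p) s -> map (minn m) s = nseq (size s) m.
  elim: s => //= k s IH /andP[]; rewrite /p -leqNgt => mk /IH ->.
  by rewrite (minn_idPl mk).
have [hy|] := boolP (has p y); last first.
  by rewrite -all_predC => /nseqE ->; left; rewrite sy.
right; have [s1 [b [s2 [yE pb a1]]]] := split_first hy.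
have hb : has p (b :: s2) by rewrite /= pb.
have [s3 [c [s4 [E pc a4]]]] := split_last hb.
pose t := behead (rcons s3 c).
have yE' : y = s1 ++ (b :: t) ++ s4.
  rewrite yE E; congr (_ ++ _); rewrite -cat_rcons; congr (_ ++ _).
  by rewrite /t; case: (s3) E => [|x s3'] [<- _].
have lt : last b t = c.
  have : last 0%N (b :: t) = last 0%N (rcons s3 c).
    by rewrite /t; case: (s3) E => [|x s3'] [<- _].
  by rewrite last_rcons.
have sz := congr1 size yE'; rewrite sy !size_cat /= in sz.
exists (size s1); first by rewrite /=; lia.
exists (size s4); first by rewrite /=; lia.
exists (b :: t); last first.
  by rewrite yE' !map_cat (nseqE _ a1) (nseqE _ a4).
exists b, t; split => //.
- by rewrite /=; lia.
- by move: py; rewrite yE' => /cat_sorted2[_ /cat_sorted2[]].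
- by rewrite lt.
- move: cw; rewrite -Ey count_low_minn yE' !count_cat; lia.
Qed.

(** At most one letter is not counted by [count high], which costs a factor
[expR kappa]. *)
Lemma refinements_few_visits : exists C : R, 1 <= C /\ forall w, (count low w <= 1)%N ->
  covered (refinements w) (C * (size w).+1%:R ^+ 2 * expR (kappa * (count high w)%:R)).
Proof.
have [C [C0 h]] := refinements_few_visits_aux.
exists ((C + 1) * expR kappa); split.
  rewrite -[leLHS]mulr1 ler_pM//; first by lra.
  by rewrite -expR0 ler_expR.
move=> w cw; apply: covered_le (h w cw) => //.
have e1 : 1 <= (size w).+1%:R ^+ 2 * expR (kappa * (size w)%:R) :> R.
  rewrite mulr_ege1//; first by rewrite exprn_ege1// ler1n.
  by rewrite -[leLHS]expR0 ler_expR mulr_ge0.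
apply: (@le_trans _ _ ((C + 1) * ((size w).+1%:R ^+ 2 * expR (kappa * (size w)%:R)))).
  by rewrite mulrDl mul1r -[C * _ * _]mulrA addrC lerD2l.
rewrite -2!mulrA ler_wpM2l ?addr_ge0//.
rewrite [leRHS]mulrCA ler_wpM2l ?exprn_ge0// -expRD ler_expR.
rewrite -[X in _ <= X + _]mulr1 -mulrDr ler_wpM2l// nat1r ler_nat.
have := count_predC low w.
have -> : count (predC low) w = count high w.
  by apply: eq_count => k; rewrite /= /low /high -leqNgt.
lia.
Qed.

Lemma split_first_low w : has low w -> exists v b w2,
  [/\ w = v ++ b :: w2, low b & all high v].
Proof.
move=> /split_first[v [b [w2 [-> lb av]]]]; exists v, b, w2; split => //.
by apply: sub_all av => k; rewrite /= /low /high -leqNgt.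
Qed.

Lemma low_high b : low b -> high b = false.
Proof. by rewrite /low /high => bq; rewrite leqNgt bq. Qed.

(** Induction over the letters [< q] of the word. The two pieces at the ends,
which are not complete excursions, contribute one polynomial factor each. *)
Lemma refinements_bound : exists C : R, 1 <= C /\ forall w,
  covered (refinements w)
    ((C * (size w).+1%:R ^+ 2) ^+ 2 * expR (kappa * (count high w)%:R)).
Proof.
have [C [C1 h]] := refinements_few_visits; exists C; split => // w.
have C0 : 0 <= C by lra.
pose D n : R := C * n.+1%:R ^+ 2.
have D1 n : 1 <= D n.
  by rewrite /D -[leLHS]mulr1 ler_pM// exprn_ege1// ler1n.
have Dle n n' : (n <= n')%N -> D n <= D n'.
  by move=> nn; rewrite /D ler_wpM2l// ler_pXn2r ?nnegrE// ler_nat.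
have first_low n : forall a w', low a -> (size (a :: w') <= n)%N ->
    covered (refinements (a :: w')) (D n * expR (kappa * (count high (a :: w'))%:R)).
  move=> a w'; elim: {w'}(size w') {-2}w' (leqnn (size w')) a => [|k IH] w' wk a la wn.
    have : (count low (a :: w') <= 1)%N by case: w' wk {wn} => //= _; rewrite la.
    move=> /h; apply: covered_le => //; rewrite ler_wpM2r ?expR_ge0//.
    exact: (@Dle (size (a :: w')) n).
  have [hl|nl] := boolP (has low w').
    have [v [b [w2 [E lb av]]]] := split_first_low hl.
    have sw : (size w' = size v + (size w2).+1)%N by rewrite E size_cat.
    have h1 := refinements_excursion la lb av.
    have h2 : covered (refinements (b :: w2)) (D n * expR (kappa * (count high (b :: w2))%:R)).
      by apply: IH => //=; move: wn => /=; lia.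
    have := @refinements_split (a :: v) b w2 _ _ h1 h2.
    rewrite E; apply: covered_le => //=.
    rewrite count_cat /= !low_high// !add0n natrD mulrDr expRD.
    by apply: eq_ler; ring.
  have : (count low (a :: w') <= 1)%N.
    by move: nl; rewrite has_count /= la; lia.
  move=> /h; apply: covered_le => //; rewrite ler_wpM2r ?expR_ge0//.
  exact: (@Dle (size (a :: w')) n).
rewrite -/(D (size w)).
have [hl|nl] := boolP (has low w).
  have [v [b [w2 [E lb av]]]] := split_first_low hl.
  have sw : (size w = size v + (size w2).+1)%N by rewrite E size_cat.
  have h1 : covered (refinements (rcons v b)) (D (size w) * expR (kappa * (count high v)%:R)).
    have : (count low (rcons v b) <= 1)%N.
      by rewrite -cats1 count_cat count_low0//= lb.
    move=> /h; apply: covered_le => //.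
    rewrite -cats1 count_cat /= low_high// !addn0 ler_wpM2r ?expR_ge0//.
    by apply: (@Dle _ (size w)); rewrite size_cat /=; lia.
  have h2 : covered (refinements (b :: w2)) (D (size w) * expR (kappa * (count high (b :: w2))%:R)).
    by apply: first_low => //=; lia.
  have := refinements_split h1 h2; rewrite {1}E -E; apply: covered_le => //.
  have -> : count high w = (count high v + count high (b :: w2))%N by rewrite E count_cat.
  rewrite natrD mulrDr expRD.
  by apply: eq_ler; ring.
have : (count low w <= 1)%N by move: nl; rewrite has_count; lia.
move=> /h; apply: covered_le => //; rewrite ler_wpM2r ?expR_ge0//.
by rewrite -[leLHS]mul1r expr2 ler_wpM2r// (le_trans _ (D1 _)).
Qed.

End refining.

(** * Topology and measurability of the shift space *)

Lemma open_ptws_coord i c : @open {ptws nat -> nat} [set g | g i = c].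
Proof.
rewrite openE => g /= gic.
have /pointwise_cvgP/(_ i) h : {ptws, nbhs (g : {ptws nat -> nat}) --> g}.
  exact: cvg_id.
have : nbhs (g i) [set c] by rewrite gic; exact: discrete_set1.
by move=> /h.
Qed.

(** The filter of the sets of functions that agree with [g] up to [n] converges
to [g] pointwise. *)
Lemma open_ptws_prefix (V : set {ptws nat -> nat}) (g : {ptws nat -> nat}) :
  open V -> V g ->
  exists n, forall g' : {ptws nat -> nat},
    (forall i, (i < n)%N -> g' i = g i) -> V g'.
Proof.
move=> oV Vg.
pose B n := [set g' : {ptws nat -> nat} | forall i, (i < n)%N -> g' i = g i].
pose F := filter_from [set: nat] B.
have FF : Filter F.
  apply: filter_from_filter; first by exists 0%N.
  by move=> i j _ _; exists (maxn i j) => // g' h; split => k kl; apply: h;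
    rewrite leq_max kl ?orbT.
have : {ptws, F --> g}.
  apply/pointwise_cvgP => t W.
  by move=> /nbhs_singleton Wt; exists t.+1 => // g' h /=; rewrite h.
move=> /(_ V) []; first by apply: open_nbhs_nbhs.
by move=> n _ h; exists n => g' hg'; apply: h.
Qed.

Section cms_measurable.
Variables (A : rel nat) (tA : cms_transitive A).
Notation X := (cms tA).
Notation shift := (@cms_shift A tA).

Definition letter i (x : X) : nat := set_val x i.

Lemma letter_iter n (x : X) i : letter i (iter n shift x) = letter (i + n) x.
Proof.
elim: n i => [|n IH] i; first by rewrite addn0.
by rewrite iterS addnS -addSn -IH.
Qed.

Lemma measurable_letter1 i c : measurable [set x : X | letter i x = c].
Proof.
by apply: sub_sigma_algebra; exists [set g | g i = c] => //; exact: open_ptws_coord.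
Qed.

Lemma measurable_letter i (S : set nat) : measurable [set x : X | S (letter i x)].
Proof.
rewrite (_ : [set _ | _] = \bigcup_(c in S) [set x | letter i x = c]).
  by apply: bigcup_measurable => c _; exact: measurable_letter1.
by apply/seteqP; split => x /= => [Sx|[c Sc ->]]//; exists (letter i x).
Qed.

Lemma cylinderE w : cylinder tA w =
  \bigcap_(i in [set: 'I_(size w)]) [set x | letter i x = nth 0%N w i].
Proof.
apply/seteqP; split => x /= h; first by move=> i _; exact: h.
by move=> i iw; exact: (h (Ordinal iw)).
Qed.

Lemma measurable_cylinder w : measurable (cylinder tA w).
Proof.
rewrite cylinderE; apply: fin_bigcap_measurable => // i _.
exact: measurable_letter1.
Qed.

(** An open set is the union of the cylinders that it contains, and there are
countably many cylinders. *)
Lemma cms_measurable_ind (C : set (set X)) : sigma_algebra setT C ->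
  (forall w, C (cylinder tA w)) -> measurable `<=` C.
Proof.
move=> sC cC; apply: smallest_sub => // U [V oV <-].
pose dec (k : nat) : option (seq nat) := choice.unpickle k.
pose B k : set X := if dec k is Some w then
  if `[< cylinder tA w `<=` set_val @^-1` V >] then cylinder tA w else set0
  else set0.
rewrite (_ : _ @^-1` _ = \bigcup_k B k).
  case: sC => C0 _; apply => k; rewrite /B; case: (dec k) => // w.
  by case: ifP.
apply/seteqP; split => x /=; last first.
  by move=> [k _]; rewrite /B; case: (dec k) => // w; case: asboolP => // h /h.
move=> Vx; have [n hn] := open_ptws_prefix oV Vx.
pose w := mkseq (fun i => letter i x) n.
exists (choice.pickle w) => //; rewrite /B /dec choice.pickleK; case: asboolP => [_|].
  by move=> i; rewrite size_mkseq => il; rewrite nth_mkseq.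
case=> y wy /=; apply: hn => i il.
by rewrite (wy i) ?size_mkseq// nth_mkseq.
Qed.

Lemma measurable_shift : measurable_fun setT shift.
Proof.
suff h : @measurable _ X `<=` [set B | measurable (shift @^-1` B)].
  by move=> _ B mB; rewrite setTI; exact: h.
apply: cms_measurable_ind.
  split => /=; first by rewrite preimage_set0.
  - by move=> B mB; rewrite setTD preimage_setC; exact: measurableC.
  - by move=> B mB; rewrite preimage_bigcup; exact: bigcupT_measurable.
move=> w /=; rewrite cylinderE preimage_bigcap.
by apply: fin_bigcap_measurable => // i _; exact: (measurable_letter1 i.+1).
Qed.

Definition trunc_letter m (x : X) : 'I_m.+1 := inord (minn m (letter 0 x)).

Lemma observable_trunc_letter m : observable (trunc_letter m).
Proof.
by move=> a; exact: (measurable_letter 0 [set c | inord (minn m c) = a]).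
Qed.

(** A single parameter bounds both the length and the alphabet; these
observables become finer as [m] grows. *)
Definition truncated_block m := itinerary shift m (trunc_letter m).

Lemma trunc_letterE m (x : X) : trunc_letter m x = minn m (letter 0 x) :> nat.
Proof. by rewrite inordK// ltnS geq_minl. Qed.

Lemma observable_truncated_block m : observable (truncated_block m).
Proof. by apply: observable_itinerary; [exact: measurable_shift|exact: observable_trunc_letter]. Qed.

Lemma truncated_blockE m (x : X) i : truncated_block m x i = minn m (letter i x) :> nat.
Proof. by rewrite ffunE trunc_letterE letter_iter. Qed.

Definition block_determined m (D : set X) :=
  forall x y, truncated_block m x = truncated_block m y -> D x -> D y.

Lemma truncated_block_le m m' x y : (m <= m')%N ->
  truncated_block m' x = truncated_block m' y ->
  truncated_block m x = truncated_block m y.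
Proof.
move=> mm E; apply/ffunP => i; apply: ord_inj; rewrite !truncated_blockE.
have im : (i < m')%N by exact: leq_trans (ltn_ord i) mm.
have := congr1 (fun u : {ffun 'I_m' -> 'I_m'.+1} => nat_of_ord (u (Ordinal im))) E.
rewrite /= !truncated_blockE /=; lia.
Qed.

Lemma block_determined_le m m' D : (m <= m')%N ->
  block_determined m D -> block_determined m' D.
Proof. by move=> mm lD x y /(truncated_block_le mm); exact: lD. Qed.

Lemma block_determinedE m D : block_determined m D ->
  D = truncated_block m @^-1` (truncated_block m @` D).
Proof.
move=> lD; apply/seteqP; split => x /=; first by exists x.
by move=> [y Dy /lD]; exact.
Qed.

Lemma measurable_block_determined m D : block_determined m D -> measurable D.
Proof.
by move=> /block_determinedE ->; apply: preimage_observable; exact: observable_truncated_block.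
Qed.

Section approximation.
Context {R : realType}.
Variable P : probability X R.

Local Open Scope ereal_scope.

Definition approximable (B : set X) := measurable B /\ forall e : R, (0 < e)%R ->
  exists m D, block_determined m D /\ P (B `\` D `|` D `\` B) <= e%:E.

Let symdiff_measurable B D m : measurable B -> block_determined m D ->
  measurable (B `\` D `|` D `\` B).
Proof.
by move=> mB /measurable_block_determined mD; apply: measurableU; exact: measurableD.
Qed.

Lemma approximableC B : approximable B -> approximable (~` B).
Proof.
move=> [mB hB]; split; first exact: measurableC.
move=> e /hB[m [D [lD PD]]]; exists m, (~` D); split.
  by move=> x y E Dx Dy; apply: Dx; exact: lD (esym E) Dy.
by rewrite !setDE !setCK [~` B `&` D]setIC [~` D `&` B]setIC setUC -!setDE.
Qed.

Lemma approximableU B1 B2 : approximable B1 -> approximable B2 -> approximable (B1 `|` B2).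
Proof.
move=> [mB1 h1] [mB2 h2]; split; first exact: measurableU.
move=> e e0; have e2 : (0 < e / 2)%R by rewrite divr_gt0.
have [m1 [D1 [l1 P1]]] := h1 _ e2. have [m2 [D2 [l2 P2]]] := h2 _ e2.
have l1' := block_determined_le (leq_maxl m1 m2) l1.
have l2' := block_determined_le (leq_maxr m1 m2) l2.
have l12 : block_determined (maxn m1 m2) (D1 `|` D2).
  by move=> x y E [Dx|Dx]; [left; exact: l1' E Dx|right; exact: l2' E Dx].
exists (maxn m1 m2), (D1 `|` D2); split => //.
apply: (@le_trans _ _ (P ((B1 `\` D1 `|` D1 `\` B1) `|` (B2 `\` D2 `|` D2 `\` B2)))).
  apply: le_measure; [apply: mem_set|apply: mem_set|].
  - exact: symdiff_measurable (measurableU _ _ mB1 mB2) l12.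
  - by apply: measurableU; [exact: symdiff_measurable mB1 l1'|exact: symdiff_measurable mB2 l2'].
  - move=> x [[[B1x|B2x] /not_orP[D1x D2x]]|[[D1x|D2x] /not_orP[B1x B2x]]].
    + by left; left.
    + by right; left.
    + by left; right.
    + by right; right.
apply: (le_trans (measureU2 _ (symdiff_measurable mB1 l1') (symdiff_measurable mB2 l2'))).
by rewrite [in leRHS](splitr e) EFinD leeD.
Qed.

(** By continuity of the measure a finite union already has almost full measure
in the countable union. *)
Lemma approximable_bigcup (B : nat -> set X) : (forall k, approximable (B k)) ->
  approximable (\bigcup_k B k).
Proof.
move=> aB; have mB k : measurable (B k) by case: (aB k).
have mU : measurable (\bigcup_k B k) by exact: bigcupT_measurable.
split => // e e0; have e2 : (0 < e / 2)%R by rewrite divr_gt0.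
pose U n := \big[setU/set0]_(i < n.+1) B i.
have aU n : approximable (U n).
  rewrite /U; elim: n => [|n IH]; first by rewrite big_ord1.
  by rewrite big_ord_recr/=; exact: approximableU.
have mUn n : measurable (U n) by case: (aU n).
have UE : \bigcup_n U n = \bigcup_k B k by exact: bigcup_bigsetU_bigcup.
have cU : P \o U @ \oo --> P (\bigcup_k B k).
  rewrite -UE; apply: nondecreasing_cvg_mu => //; first by rewrite UE.
  move=> m n mn; apply/subsetPset; apply: subset_bigsetU; exact: mn.
have [n Un] : exists n, P (\bigcup_k B k `\` U n) <= (e / 2)%:E.
  move: cU; rewrite -(fineK (fin_num_measure P _ mU)).
  move=> /fine_cvgP[_ /cvgrPdist_le/(_ _ e2)[n _ /(_ n (leqnn n))]] /= hn.
  exists n.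
  have UB : U n `<=` \bigcup_k B k by rewrite -UE; exact: bigcup_sup.
  rewrite measureD//; last by rewrite ltey_eq fin_num_measure.
  rewrite setIidr// -(fineK (fin_num_measure P _ (mUn n))) -(fineK (fin_num_measure P _ mU)).
  rewrite -EFinB lee_fin; exact: le_trans (ler_norm _) hn.
have [_ /(_ _ e2)[m [D [lD PD]]]] := aU n.
exists m, D; split => //.
apply: (@le_trans _ _ (P ((\bigcup_k B k `\` U n) `|` (U n `\` D `|` D `\` U n)))).
  have mD := measurable_block_determined lD.
  apply: le_measure; [apply: mem_set|apply: mem_set|].
  - exact: symdiff_measurable mU lD.
  - apply: measurableU; [exact: measurableD|exact: symdiff_measurable (mUn n) lD].
  - move=> x [[Bx nDx]|[Dx nBx]].
      have [Ux|nUx] := pselect (U n x); first by right; left.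
      by left.
    right; right; split => // Ux; apply: nBx; rewrite -UE; by exists n.
rewrite [in leRHS](splitr e) EFinD.
apply: (le_trans (measureU2 _ (measurableD mU (mUn n)) (symdiff_measurable (mUn n) lD))).
by rewrite leeD.
Qed.

Lemma measurable_approximable B : measurable B -> approximable B.
Proof.
move: B; apply: cms_measurable_ind.
  have a0 : approximable set0.
    split => // e e0; exists 0%N, set0; split => //.
    by rewrite !setD0 setU0 measure0 lee_fin ltW.
  split => //; first by move=> B aB; rewrite setTD; exact: approximableC.
  by move=> B aB; exact: approximable_bigcup.
move=> w; split; first exact: measurable_cylinder.
move=> e e0.
(* Larger than the length of w and than each of its letters, so that
   truncation does not affect them. *)
pose m := (size w + \sum_(k <- w) k).+1.
exists m, (cylinder tA w); split; last first.
  by rewrite setDv setU0 measure0 lee_fin ltW.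
move=> x y E wx i iw.
have im : (i < m)%N by rewrite /m; lia.
have := congr1 (fun u : {ffun 'I_m -> 'I_m.+1} => nat_of_ord (u (Ordinal im))) E.
rewrite /= !truncated_blockE /= /letter wx// => Exy.
have wm : (nth 0%N w i < m)%N.
  rewrite /m ltnS (big_nth 0%N) (bigD1_seq i) ?mem_index_iota ?iota_uniq//=; lia.
move: Exy wm; move: (nth 0%N w i) (set_val y i) => k l; clear; move: m => m'; lia.
Qed.

End approximation.

End cms_measurable.

(** * Truncated letters generate *)

Section kolmogorov_sinai.
Variables (A : rel nat) (tA : cms_transitive A) (R : realType).
Notation X := (cms tA).
Notation shift := (@cms_shift A tA).
Variable P : probability X R.
Hypothesis Pinv : invariant_measure shift P.

Let mshift : measurable_fun setT shift := @measurable_shift A tA.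

Lemma entropy_rate_truncated_block m :
  entropy_rate P shift (truncated_block (tA := tA) m) <=
  entropy_rate P shift (trunc_letter (tA := tA) m).
Proof. exact: (entropy_rate_itinerary mshift Pinv m (@observable_trunc_letter _ tA m)). Qed.

(** Each event [Y = a] is approximated in measure by an event that depends on a
truncated block, so that the conditional entropy of [Y] given the block is
small; and the entropy rate of the block process is at most that of the
truncated letters. *)
Lemma ks_generator k (Y : X -> 'I_k) (e : R) : observable Y -> 0 < e ->
  exists m1, forall m, (m1 <= m)%N ->
    entropy_rate P shift Y <= entropy_rate P shift (trunc_letter (tA := tA) m) + e.
Proof.
move=> mY e0.
pose k1 : R := k%:R + 1.
have k10 : 0 < k1 by rewrite ltr_wpDl.
have [K hK] := expR_dominates (2 * k1 / e).
have {}hK := hK K (leqnn K).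
(* With these K and eta the bound of cond_entropy_le splits into two parts, of
   at most e / 2 each; k1 avoids a division by k, which may be 0. *)
pose eta := e / (2 * k1 * (1 + K%:R)).
have K1 : 0 < 1 + K%:R :> R by rewrite ltr_pwDl.
have eta0 : 0 < eta by rewrite divr_gt0// !mulr_gt0.
have hD a : exists mD : nat * set X, block_determined mD.1 mD.2 /\
    (P (Y @^-1` [set a] `\` mD.2 `|` mD.2 `\` Y @^-1` [set a]) <= eta%:E)%E.
  by have [_ /(_ _ eta0)[m [D [lD PD]]]] := measurable_approximable P (mY a); exists (m, D).
have {hD}[mD hD] := choice hD.
exists (\max_a (mD a).1)%N => m mm.
pose D a := (mD a).2.
have lD a : block_determined m (D a).
  by have [l _] := hD a; apply: block_determined_le l; apply: leq_trans mm; exact: leq_bigmax.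
have mB := @observable_truncated_block _ tA m.
have mDa a : measurable (D a) by exact: measurable_block_determined (lD a).
pose C a : pred {ffun 'I_m -> 'I_m.+1} :=
  fun b => `[< exists2 x, D a x & truncated_block m x = b >].
have CE a : truncated_block (tA := tA) m @^-1` [set b | C a b] = D a.
  apply/seteqP; split => x /=; last by move=> Dx; apply/asboolP; exists x.
  by move=> /asboolP[y Dy E]; exact: lD E Dy.
have Psub B B' : measurable B -> measurable B' -> B `<=` B' ->
    (P B' <= eta%:E)%E -> fine (P B) <= eta.
  move=> mB1 mB2 BB h; rewrite -lee_fin fineK ?fin_num_measure//.
  by apply: le_trans h; apply: le_measure => //; exact: mem_set.
have mYa a : measurable (Y @^-1` [set a]) := mY a.
have mS a : measurable (Y @^-1` [set a] `\` D a `|` D a `\` Y @^-1` [set a]).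
  by apply: measurableU; exact: measurableD.
have fib a (E : pred _) : \sum_(b | E b) law P (fun x => (Y x, truncated_block m x)) (a, b) =
    fine (P (Y @^-1` [set a] `&` truncated_block m @^-1` [set b | E b])).
  rewrite -(sumr_fiber _ a E) -(law_pred P (fun c => (c.1 == a) && E c.2) (observable_pair mY mB)).
  congr (fine (P _)); apply/seteqP; split => x /=; first by move=> /andP[/eqP].
  by move=> [-> ->]; rewrite eqxx.
apply: le_trans (entropy_rate_cond mshift Pinv mY mB) _.
apply: lerD; first exact: entropy_rate_truncated_block.
apply: (le_trans (cond_entropy_le (C := C) (eta := eta) (K := K%:R) mY mB _ _ _)) => //.
- move=> a; rewrite sumrB fib -(law_pred P (C a) mB) CE.
  apply: le_trans (_ : fine (P (D a `\` Y @^-1` [set a])) <= _).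
    rewrite measureD//; last by rewrite ltey_eq fin_num_measure.
    by rewrite fineB ?fin_num_measure// 1?setIC//; exact: measurableI.
  apply: (Psub _ _ _ (mS a)); first exact: measurableD.
    by move=> x; right.
  by have [] := hD a.
- move=> a; rewrite fib.
  apply: (Psub _ _ _ (mS a)).
  + by apply: measurableI => //; exact: (preimage_observable _ mB).
  + move=> x [Yx nC]; left; split => // Dx; move/negP: nC; apply.
    by apply/asboolP; exists x.
  + by have [] := hD a.
rewrite card_ord.
have -> : eta + K%:R * eta = e / (2 * k1).
  by rewrite /eta; field; rewrite !gt_eqF.
have h2 : expR (- K%:R) <= e / (2 * k1).
  rewrite expRN -[leRHS]invrK lef_pV2 ?posrE ?expR_gt0 ?invr_gt0 ?divr_gt0 ?mulr_gt0//.
  by rewrite invf_div.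
apply: (@le_trans _ _ (k1 * (e / (2 * k1) + e / (2 * k1)))).
  apply: ler_pM => //; last by rewrite lerD2l.
  - by rewrite addr_ge0 ?expR_ge0// divr_ge0 ?mulr_ge0 ?ltW.
  - by rewrite /k1 lerDl.
by apply: eq_ler; field; rewrite gt_eqF.
Qed.

Lemma trunc_letter_comp m0 m : (m0 <= m)%N ->
  (fun i : 'I_m.+1 => inord (minn m0 i) : 'I_m0.+1) \o trunc_letter (tA := tA) m = trunc_letter m0.
Proof.
move=> mm; apply/funext => x; apply: ord_inj.
rewrite /= inordK ?ltnS ?geq_minl// !trunc_letterE; lia.
Qed.

(** A word of positive probability is the truncation of the beginning of some
point, which is an admissible word; so the words to be counted are refinements. *)
Lemma entropy_rate_refine (q m0 m : nat) (kappa C : R) : (q <= m0)%N -> (m0 <= m)%N ->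
  0 < C ->
  (forall w, covered (refinements A m0 m w)
    ((C * (size w).+1%:R ^+ 2) ^+ 2 * expR (kappa * (count (fun k => (q <= k)%N) w)%:R))) ->
  entropy_rate P shift (trunc_letter (tA := tA) m) <=
  entropy_rate P shift (trunc_letter (tA := tA) m0) +
    kappa * fine (P [set x : X | (q <= letter 0 x)%N]).
Proof.
move=> qm mm C0 hC.
have mm0 := @observable_trunc_letter _ tA m0. have mm1 := @observable_trunc_letter _ tA m.
pose h (i : 'I_m.+1) : 'I_m0.+1 := inord (minn m0 i).
have hE : h \o trunc_letter (tA := tA) m = trunc_letter m0 := trunc_letter_comp mm.
have -> : fine (P [set x : X | (q <= letter 0 x)%N]) =
    \sum_(a : 'I_m0.+1 | (q <= a)%N) law P (h \o trunc_letter (tA := tA) m) a.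
  rewrite hE -(law_pred P (fun a : 'I_m0.+1 => (q <= a)%N) mm0).
  by congr (fine (P _)); apply/seteqP; split => x /=; rewrite trunc_letterE; lia.
rewrite -[X in _ <= entropy_rate P shift X + _]hE.
apply: (entropy_rate_card mshift Pinv (C := C)) => // n w.
pose sq (k : nat) (u : {ffun 'I_n -> 'I_k}) := [seq nat_of_ord (u i) | i <- enum 'I_n].
have := hC (sq _ w).
have -> : size (sq m0.+1 w) = n by rewrite size_map size_enum_ord.
have -> : count (fun k => (q <= k)%N) (sq m0.+1 w) = #|[pred i | (q <= w i)%N]|.
  by rewrite count_map count_enum.
apply: (card_covered (f := sq m.+1)).
  move=> u u' E; apply/ffunP => i; apply: ord_inj.
  by have /eq_in_map/(_ i) := E; rewrite mem_enum; exact.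
move=> u /andP[/eqP hu lu].
have [x xu] : exists x, itinerary shift n (trunc_letter (tA := tA) m) x = u.
  apply: contrapT => nx; move: lu; rewrite /law (_ : _ @^-1` _ = set0) ?measure0 ?ltxx//.
  by apply/seteqP; split => // x xu; apply: nx; exists x.
have sqE k : sq k.+1 (itinerary shift n (trunc_letter k) x) =
    [seq minn k (letter i x) | i <- iota 0 n].
  rewrite -val_enum_ord -map_comp; apply: eq_map => i /=.
  by rewrite ffunE trunc_letterE letter_iter.
exists [seq letter i x | i <- iota 0 n]; last first.
  by rewrite -map_comp -xu sqE.
split.
  apply/(sortedP 0%N) => i; rewrite size_map size_iota => il.
  rewrite !(nth_map 0%N) ?size_iota ?(ltnW il)// !nth_iota ?(ltnW il)//.
  exact: (set_valP x).
rewrite -map_comp; have -> : w = itinerary shift n (trunc_letter m0) x.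
  by rewrite -hu -xu -hE; apply/ffunP => i; rewrite !ffunE.
by rewrite sqE.
Qed.

End kolmogorov_sinai.

(** * Convergence on cylinders *)

Section vague.
Variables (A : rel nat) (tA : cms_transitive A) (R : realType).
Notation X := (cms tA).
Notation shift := (@cms_shift A tA).
Variable mu_ : nat -> probability X R.
Hypothesis mu_inv : forall n, invariant_measure shift (mu_ n).
Variable mu : {measure set X -> \bar R}.
Hypothesis mu_inv_lim : invariant_measure shift mu.
Hypothesis mu_le1 : (mu setT <= 1)%E.
Hypothesis mu_cvg : forall w : seq nat, (0 < size w)%N -> sorted A w ->
  (fun n => mu_ n (cylinder tA w)) @ \oo --> mu (cylinder tA w).

Lemma mu_fin B : measurable B -> mu B \is a fin_num.
Proof.
move=> mB; rewrite ge0_fin_numE//; apply: (@le_lt_trans _ _ (mu setT)).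
  by apply: le_measure => //; exact: mem_set.
by apply: (le_lt_trans mu_le1); rewrite ltry.
Qed.

Lemma cylinder_sorted w : (0 < size w)%N -> cylinder tA w !=set0 -> sorted A w.
Proof.
move=> w0 [x wx]; apply/(sortedP 0%N) => i il.
rewrite -!wx//; last exact: ltnW.
exact: (set_valP x).
Qed.

Lemma cvg_cylinder w : (0 < size w)%N ->
  (fun n => fine (mu_ n (cylinder tA w))) @ \oo --> fine (mu (cylinder tA w)).
Proof.
move=> w0; have [sw|nw] := boolP (sorted A w).
  have := mu_cvg w0 sw; have := mu_fin (measurable_cylinder (tA := tA) w).
  by case: (mu (cylinder tA w)) => // r _ /fine_cvgP[].
have -> : cylinder tA w = set0.
  apply: contrapT => /eqP/set0P/(cylinder_sorted w0) sw.
  by rewrite sw in nw.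
rewrite measure0; under eq_fun do rewrite measure0.
exact: cvg_cst.
Qed.

Definition determined N (D : set X) := forall x y,
  (forall i, (i < N)%N -> letter i x = letter i y) -> D x -> D y.

Let dec (k : nat) : option (seq nat) := choice.unpickle k.

(** [D] is cut into the cylinders of length [N] that it contains. They are
indexed by the codes of the words, which makes the family disjoint. *)
Let piece N (D : set X) k : set X := if dec k is Some w then
  if `[< [/\ choice.pickle w = k, size w = N & cylinder tA w `<=` D] >]
  then cylinder tA w else set0
  else set0.

Let bigcup_piece N D : determined N D -> \bigcup_k piece N D k = D.
Proof.
move=> dD; apply/seteqP; split => x.
  by move=> [k _]; rewrite /piece; case: (dec k) => // w; case: asboolP => // -[_ _ h] /h.
move=> Dx; pose w := mkseq (fun i => letter i x) N.
exists (choice.pickle w) => //; rewrite /piece /dec choice.pickleK.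
case: asboolP => [_|[]]; last first.
  split => //; first by rewrite size_mkseq.
  move=> y wy; apply: dD Dx => i iN.
  by rewrite [RHS](wy i) ?size_mkseq// nth_mkseq.
by move=> i; rewrite size_mkseq => il; rewrite nth_mkseq.
Qed.

Let measurable_piece N D k : measurable (piece N D k).
Proof.
rewrite /piece; case: (dec k) => // w; case: asboolP => // _.
exact: measurable_cylinder.
Qed.

Let trivIset_piece N D : trivIset setT (piece N D).
Proof.
move=> k k' _ _ [x []]; rewrite /piece /dec.
case: (choice.unpickle k) => // w; case: (choice.unpickle k') => // w'.
case: asboolP => // -[<- sw _] wx; case: asboolP => // -[<- sw' _] w'x.
congr choice.pickle; apply: (@eq_from_nth _ 0%N) => [|i]; rewrite sw ?sw'// => iN.
by rewrite -wx ?sw// w'x// sw'.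
Qed.

Let cvg_piece N D k : (0 < N)%N ->
  (fun n => fine (mu_ n (piece N D k))) @ \oo --> fine (mu (piece N D k)).
Proof.
move=> N0; have c0 : (fun n => fine (mu_ n (set0 : set X))) @ \oo --> fine (mu set0).
  by rewrite measure0; under eq_fun do rewrite measure0; exact: cvg_cst.
rewrite /piece; case: (dec k) => // w; case: asboolP => // -[_ sw _].
by apply: cvg_cylinder; rewrite sw.
Qed.

Lemma measurable_determined N D : determined N D -> measurable D.
Proof.
by move=> /bigcup_piece <-; apply: bigcupT_measurable => k; exact: measurable_piece.
Qed.

Lemma determined_le N N' D : (N <= N')%N -> determined N D -> determined N' D.
Proof.
by move=> NN dD x y h; apply: dD => i iN; apply: h; exact: leq_trans iN NN.
Qed.

(** [D] is a countable disjoint union of cylinders, and a finite subunion has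
nearly full [mu]-measure. *)
Lemma liminf_determined N D (e : R) : determined N D -> 0 < e ->
  \forall n \near \oo, fine (mu D) - e <= fine (mu_ n D).
Proof.
move=> /(determined_le (leqnSn N)) dD e0.
have e2 : 0 < e / 2 by rewrite divr_gt0.
have mD := measurable_determined dD.
have mp k := @measurable_piece N.+1 D k.
pose U K := \big[setU/set0]_(k < K) piece N.+1 D k.
have mU K : measurable (U K) by apply: bigsetU_measurable.
have UD K : U K `<=` D.
  by rewrite -(bigcup_piece dD) /U -bigcup_mkord; apply: bigcup_sub => i _; exact: bigcup_sup.
have cU : mu \o U @ \oo --> mu D.
  have -> : mu D = mu (\bigcup_k \big[setU/set0]_(i < k.+1) piece N.+1 D i).
    by rewrite bigcup_bigsetU_bigcup bigcup_piece.
  rewrite -(@cvg_shiftS _ (mu \o U)).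
  apply: (@nondecreasing_cvg_mu _ _ _ mu (fun K => U K.+1)) => //.
  - by apply: bigcupT_measurable => i; exact: (mU i.+1).
  - by move=> m n mn; apply/subsetPset; apply: subset_bigsetU; rewrite ltnS.
have [K hK] : exists K, fine (mu D) - e / 2 <= fine (mu (U K)).
  move: cU; rewrite -(fineK (mu_fin mD)).
  move=> /fine_cvgP[_ /cvgrPdist_le/(_ _ e2)[K _ /(_ K (leqnn K))]] /= h.
  by exists K; have := le_trans (ler_norm _) h; lra.
have addU (m : {measure set X -> \bar R}) : (forall B, measurable B -> m B \is a fin_num) ->
    fine (m (U K)) = \sum_(k < K) fine (m (piece N.+1 D k)).
  move=> mfin; rewrite /U measure_bigsetU//.
  by rewrite sum_fine// => i _; exact: mfin.
have cK : (fun n => fine (mu_ n (U K))) @ \oo --> fine (mu (U K)).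
  rewrite (addU mu mu_fin).
  have -> : (fun n => fine (mu_ n (U K))) =
      fun n => \sum_(k < K) fine (mu_ n (piece N.+1 D k)).
    by apply/funext => n; apply: addU => B; exact: fin_num_measure.
  by apply: cvg_big => [|k _]; [exact: add_continuous|exact: cvg_piece].
move/cvgrPdist_le : cK => /(_ _ e2); apply: filterS => n /= hn.
have h1 : fine (mu_ n (U K)) <= fine (mu_ n D).
  by apply: fine_le; rewrite ?fin_num_measure//; apply: le_measure => //; exact: mem_set.
have := le_trans (ler_norm _) hn; lra.
Qed.

(** Scheffe's argument: the lower bound applies to [D] and to its complement in
[x_i = c], whose total mass converges because it is, by invariance, the mass
of the cylinder [c]. No mass can then be gained in [D]. *)
Lemma cvg_determined N D i c : determined N D -> D `<=` [set x | letter i x = c] ->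
  (fun n => fine (mu_ n D)) @ \oo --> fine (mu D).
Proof.
move=> dD DE; set E := [set x | _] in DE.
have mD := measurable_determined dD.
have mE : measurable E by exact: measurable_letter1.
have iterE : E = iter i shift @^-1` (cylinder tA [:: c]).
  apply/seteqP; split => x /=.
    by move=> xc [|//] _ /=; rewrite -[LHS]/(letter 0 _) letter_iter.
  by move=> /(_ 0%N isT) /=; rewrite -[LHS]/(letter 0 _) letter_iter.
have mci : measurable (cylinder tA [:: c]) by exact: measurable_cylinder.
have muE : mu E = mu (cylinder tA [:: c]).
  rewrite iterE; elim: (i) => [//|j IH].
  rewrite (_ : _ @^-1` _ = shift @^-1` (iter j shift @^-1` cylinder tA [:: c])).
    by rewrite mu_inv_lim//; apply: measurable_iter => //; exact: measurable_shift.
  by apply/seteqP; split => x /=; rewrite -iterSr.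
have muEn n : mu_ n E = mu_ n (cylinder tA [:: c]).
  by rewrite iterE measure_iter//; exact: measurable_shift.
have dED : determined (maxn N i.+1) (E `\` D).
  move=> x y h [Ex nDx]; split; first by rewrite /E /= -h// leq_maxr.
  move=> Dy; apply: nDx; apply: (dD y x) => // j jN; rewrite h// leq_max jN//.
have mED : measurable (E `\` D) by exact: measurableD.
have splitE (m : {measure set X -> \bar R}) : (forall B, measurable B -> m B \is a fin_num) ->
    fine (m E) = fine (m D) + fine (m (E `\` D)).
  move=> mfin; rewrite -fineD ?mfin// -measureU//.
    by rewrite setDUK.
  by rewrite setDIK.
have cE : (fun n => fine (mu_ n E)) @ \oo --> fine (mu E).
  by rewrite muE; under eq_fun do rewrite muEn; exact: cvg_cylinder.
apply/cvgrPdist_le => e e0; have e2 : 0 < e / 2 by rewrite divr_gt0.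
near=> n.
have h1 : fine (mu D) - e / 2 <= fine (mu_ n D) by near: n; exact: (liminf_determined dD).
have h2 : fine (mu (E `\` D)) - e / 2 <= fine (mu_ n (E `\` D)).
  by near: n; exact: (liminf_determined dED).
have h3 : `|fine (mu E) - fine (mu_ n E)| <= e / 2.
  by near: n; move/cvgrPdist_le: cE; exact.
have h4 := splitE mu mu_fin.
have h5 : fine (mu_ n E) = fine (mu_ n D) + fine (mu_ n (E `\` D)).
  by apply: splitE => B; exact: fin_num_measure.
move: h3; rewrite ler_norml => /andP[h3 h3'].
rewrite ler_norml; apply/andP; split; lra.
Unshelve. all: by end_near. Qed.

End vague.

(** * Comparison of the entropy with a truncation *)

Section comparison.
Variables (A : rel nat) (tA : cms_transitive A) (R : realType) (a : nat).
Hypothesis htop : (gurevich_entropy R tA a < +oo)%E.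
Notation X := (cms tA).
Notation shift := (@cms_shift A tA).

(** The truncation at a large [m] nearly computes the entropy and is compared with
the truncation at [m0] by counting refinements. How large [m] must be depends
on the measure, but [m0] does not, which is what the passage to the limit
requires. *)
Lemma ks_entropy_truncation (q M : nat) (kappa : R) : (0 < q)%N -> 0 <= kappa ->
  escaping_bound A M q kappa ->
  exists2 m0, (q <= m0)%N & forall P : probability X R, invariant_measure shift P ->
    (ks_entropy shift P <= (entropy_rate P shift (trunc_letter (tA := tA) m0) +
      kappa * fine (P [set x : X | (q <= letter 0 x)%N]))%:E)%E.
Proof.
move=> q0 k0 hB; have [n0 h0] := hB.
(* Excursions of more than n1 steps are long enough to be escaping words, with
   two visits to the letters < q, and for the bound hB to apply. *)
pose n1 := maxn (2 * M) n0.+1.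
have [m1 h1] := letters_bounded htop q n1.
pose m0 := maxn q m1; exists m0; first exact: leq_maxl.
have short b c l t : (b < q)%N -> (c < q)%N -> (l <= n1)%N -> walk A b c l t ->
    all (fun k => (k < m0)%N) t.
  move=> bq cq ln ct; apply: sub_all (h1 b c l t bq cq ln ct) => k km.
  by rewrite leq_max km orbT.
move=> P Pinv; apply: ks_entropy_le => //; first exact: measurable_shift.
move=> k Y mY; rewrite lee_fin; apply/ler_addgt0Pr => e e0.
have [m2 hm2] := ks_generator Pinv mY e0.
apply: (le_trans (hm2 (maxn m0 m2) (leq_maxr _ _))); rewrite lerD2r.
have n1E n : (n1 <= n.+1)%N -> covered (escaping_words A M q n) (expR (kappa * n%:R)).
  by move=> n1n; apply: h0; move: n1n; rewrite /n1; lia.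
have [C [C1 hC]] := @refinements_bound R A tA (covered_walk htop) q M kappa q0 k0 hB m0 n1
  (leq_maxl _ _) short (leq_maxl _ _) n1E (maxn m0 m2) (leq_maxl _ _).
apply: (entropy_rate_refine Pinv (C := C)) => //; try exact: leq_maxl.
by lra.
Qed.

End comparison.

(** * Upper limit of the entropies *)

Section limit.
Variables (A : rel nat) (tA : cms_transitive A) (R : realType).
Notation X := (cms tA).
Notation shift := (@cms_shift A tA).
Variable mu_ : nat -> probability X R.
Hypothesis mu_inv : forall n, invariant_measure shift (mu_ n).
Variable mu : {measure set X -> \bar R}.
Hypothesis mu_inv_lim : invariant_measure shift mu.
Hypothesis mu_le1 : (mu setT <= 1)%E.
Hypothesis mu_cvg : forall w : seq nat, (0 < size w)%N -> sorted A w ->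
  (fun n => mu_ n (cylinder tA w)) @ \oo --> mu (cylinder tA w).

Lemma fine_letter_lt (m : {measure set X -> \bar R}) q :
  (forall B, measurable B -> m B \is a fin_num) ->
  fine (m [set x : X | (letter 0 x < q)%N]) = \sum_(c < q) fine (m [set x : X | letter 0 x = c]).
Proof.
move=> mfin.
rewrite (_ : [set x : X | _] = \big[setU/set0]_(c < q) [set x : X | letter 0 x = c]).
  rewrite (measure_bigsetU m (F := fun c => [set x : X | letter 0 x = c])).
  - by rewrite sum_fine// => c _; apply: mfin; exact: measurable_letter1.
  - by move=> c; exact: measurable_letter1.
  - by move=> c c' _ _ [x [/= -> ->]].
rewrite -(bigcup_mkord q (fun c => [set x : X | letter 0 x = c])).
by apply/seteqP; split => x /= => [xq|[c cq ->]]//; exists (letter 0 x).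
Qed.

Lemma cvg_letter_lt q : (fun n => fine (mu_ n [set x : X | (letter 0 x < q)%N])) @ \oo
  --> fine (mu [set x : X | (letter 0 x < q)%N]).
Proof.
rewrite fine_letter_lt; last by move=> B; exact: mu_fin.
have -> : (fun n => fine (mu_ n [set x : X | (letter 0 x < q)%N])) =
    fun n => \sum_(c < q) fine (mu_ n [set x : X | letter 0 x = c]).
  by apply/funext => n; apply: fine_letter_lt => B; exact: fin_num_measure.
apply: cvg_big => [|c _]; first exact: add_continuous.
apply: (cvg_determined mu_inv mu_inv_lim mu_le1 mu_cvg (N := 1) (i := 0%N) (c := c)) => //.
by move=> x y h /=; rewrite h.
Qed.

(** These masses add up to the total mass of [mu], which may be less than 1. *)
Definition cell_mass m0 N (w : {ffun 'I_N -> 'I_m0.+1}) : R :=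
  fine (mu (itinerary shift N (trunc_letter (tA := tA) m0) @^-1` [set w])).

Lemma measurable_cell m0 N (w : {ffun 'I_N -> 'I_m0.+1}) :
  measurable (itinerary shift N (trunc_letter (tA := tA) m0) @^-1` [set w]).
Proof.
by apply: observable_itinerary; [exact: measurable_shift|exact: observable_trunc_letter].
Qed.

Lemma cell_mass01 m0 N (w : {ffun 'I_N -> 'I_m0.+1}) : 0 <= cell_mass w <= 1.
Proof.
have mw := measurable_cell w; rewrite /cell_mass fine_ge0//=.
rewrite -lee_fin fineK; last exact: mu_fin.
by apply: le_trans mu_le1; apply: le_measure => //; exact: mem_set.
Qed.

(** The masses of all cells converge to those of [mu], except for the cell of the
constant word in the symbol [m0]; its contribution is at most 1, since
[- t ln t <= 1]. *)
Lemma block_entropy_limsup m0 N (e : R) : 0 < e ->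
  \forall n \near \oo, block_entropy (mu_ n) shift (trunc_letter (tA := tA) m0) N <=
    shannon (@cell_mass m0 N) + 1 + e.
Proof.
move=> e0.
pose K : R := #|{ffun 'I_N -> 'I_m0.+1}|%:R + 1.
have K0 : 0 < K by rewrite ltr_wpDl.
pose d := e / K; have d0 : 0 < d by rewrite divr_gt0.
(* All letters are replaced by the symbol m0. *)
pose star : {ffun 'I_N -> 'I_m0.+1} := [ffun=> ord_max].
pose l n w := law (mu_ n) (itinerary shift N (trunc_letter (tA := tA) m0)) w.
pose phi (t : R) := - (t * ln t).
have near1 w : w != star -> \forall n \near \oo, phi (l n w) <= phi (cell_mass w) + d.
  move=> ws; have [i wi] : exists i, (w i < m0)%N.
    apply: contrapT => nw; move/eqP: ws; apply; apply/ffunP => i; rewrite ffunE.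
    apply: ord_inj; apply/eqP; rewrite eqn_leq -ltnS ltn_ord /= leqNgt.
    by apply/negP => wi; apply: nw; exists i.
  have cw : (fun n => l n w) @ \oo --> cell_mass w.
    apply: (cvg_determined mu_inv mu_inv_lim mu_le1 mu_cvg (N := N) (i := i) (c := w i)).
    - move=> x y h /= xw; rewrite -xw; apply/ffunP => j; apply: ord_inj.
      by rewrite !ffunE !trunc_letterE !letter_iter !add0n h.
    - move=> x /= xw; have := congr1 (fun u : {ffun 'I_N -> 'I_m0.+1} => nat_of_ord (u i)) xw.
      rewrite /= ffunE trunc_letterE letter_iter add0n => E.
      by move: wi; rewrite -E; move: (letter i x) => L; lia.
  have /andP[c0 _] := cell_mass01 w.
  have [r r0 hr] := neg_xlnx_upper c0 d0.
  move/cvgrPdist_le : cw => /(_ _ r0); apply: filterS => n hn.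
  by apply: hr; [exact: law_ge0|rewrite distrC].
have : \forall n \near \oo, forall w, w != star -> phi (l n w) <= phi (cell_mass w) + d.
  apply: filter_forall => w; have [->|ws] := eqVneq w star.
    by apply: nearW => n.
  by have := near1 w ws; apply: filterS => n h _.
apply: filterS => n hn.
rewrite /block_entropy /shannon -!sumrN (bigD1 star)//= [in leRHS](bigD1 star)//=.
have h1 : - (l n star * ln (l n star)) <= 1.
  have := @gibbs_scalar R (l n star) 1 (law_ge0 _ _ _) ltr01.
  rewrite ln1 mulr0 oppr0 add0r.
  have := law_ge0 (mu_ n) (itinerary shift N (trunc_letter (tA := tA) m0)) star.
  by rewrite -/(l n star); lra.
have h2 : 0 <= - (cell_mass star * ln (cell_mass star)).
  have /andP[c0 c1] := cell_mass01 star.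
  by rewrite -mulrN mulr_ge0// oppr_ge0 ln_le0.
have h3 : \sum_(w | w != star) - (l n w * ln (l n w)) <=
    \sum_(w | w != star) - (cell_mass w * ln (cell_mass w)) + e.
  apply: (@le_trans _ _ (\sum_(w | w != star) (- (cell_mass w * ln (cell_mass w)) + d))).
    by apply: ler_sum => w ws; exact: hn.
  rewrite big_split/= lerD2l sumr_const.
  apply: (@le_trans _ _ (d *+ #|{ffun 'I_N -> 'I_m0.+1}|)).
    by rewrite ler_wpMn2l ?ltW// max_card.
  rewrite -mulr_natr /d -mulrA; apply: ler_piMr; first exact: ltW.
  by rewrite mulrC ler_pdivrMr// mul1r /K lerDl.
move: h1 h2 h3; rewrite /l; lra.
Qed.

Lemma limsup_ks_block q m0 N (kappa e : R) : (0 < N)%N -> 0 <= kappa -> 0 < e ->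
  (forall n, (ks_entropy shift (mu_ n) <=
    (entropy_rate (mu_ n) shift (trunc_letter (tA := tA) m0) +
      kappa * fine (mu_ n [set x : X | (q <= letter 0 x)%N]))%:E)%E) ->
  (limn_esup (fun n => ks_entropy shift (mu_ n)) <=
    ((shannon (@cell_mass m0 N) + 1 + e) / N%:R +
     kappa * (1 - fine (mu [set x : X | (letter 0 x < q)%N]) + e))%:E)%E.
Proof.
move=> N0 k0 e0 h; apply: limn_esup_le_near.
have c1 := block_entropy_limsup m0 N e0.
have c2 : \forall n \near \oo, `|fine (mu [set x : X | (letter 0 x < q)%N]) -
   fine (mu_ n [set x : X | (letter 0 x < q)%N])| <= e.
  by have /cvgrPdist_le := @cvg_letter_lt q; exact.
near=> n.
apply: le_trans (h n) _; rewrite lee_fin; apply: lerD.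
  have mt := @observable_trunc_letter _ tA m0.
  apply: le_trans (entropy_rate_le (@measurable_shift _ tA) (mu_inv n) mt N0) _.
  by rewrite ler_pM2r ?invr_gt0 ?ltr0n//; near: n.
rewrite ler_wpM2l//.
have -> : [set x : X | (q <= letter 0 x)%N] = ~` [set x : X | (letter 0 x < q)%N].
  by apply/seteqP; split => x /=; [rewrite leqNgt => /negP|move=> /negP; rewrite -leqNgt].
have mq : measurable [set x : X | (letter 0 x < q)%N].
  exact: (measurable_letter 0 [set c | (c < q)%N]).
rewrite probability_setC// fineB ?fin_num_measure//=.
have : `|fine (mu [set x : X | (letter 0 x < q)%N]) -
   fine (mu_ n [set x : X | (letter 0 x < q)%N])| <= e by near: n.
by rewrite ler_norml => /andP[]; lra.
Unshelve. all: by end_near. Qed.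

(** For [mu = 0] the normalization is an arbitrary probability measure; with the
value 0 in this case, the two cases of the final inequality are one formula. *)
Definition limit_entropy : \bar R := (if mu setT == 0 then 0
  else mu setT * ks_entropy shift (mnormalize mu \d_point))%E.

Let lam := fine (mu setT).

Lemma mu_setTE : mu setT = lam%:E.
Proof. by rewrite /lam fineK//; exact: mu_fin. Qed.

Lemma mnormalizeE B : 0 < lam -> mnormalize mu \d_point B = (mu B * (lam^-1)%:E)%E.
Proof.
by move=> l0; rewrite /mnormalize mu_setTE eqe gt_eqF.
Qed.

Lemma lam_ge0 : 0 <= lam.
Proof. by rewrite /lam fine_ge0. Qed.

Lemma lam_le1 : lam <= 1.
Proof. by rewrite -lee_fin -mu_setTE. Qed.

Lemma mnormalize_inv : 0 < lam -> invariant_measure shift (mnormalize mu \d_point).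
Proof. by move=> l0 B mB; rewrite !mnormalizeE// mu_inv_lim. Qed.

Lemma shannon_cell_mass m0 N : 0 < lam ->
  shannon (@cell_mass m0 N) =
  lam * block_entropy (mnormalize mu \d_point) shift (trunc_letter (tA := tA) m0) N - lam * ln lam.
Proof.
move=> l0.
have mn : observable (itinerary shift N (trunc_letter (tA := tA) m0)) by exact: measurable_cell.
rewrite /block_entropy -shannon_scale//; last 2 first.
- by move=> w; exact: law_ge0.
- exact: law_sum1.
congr (shannon _); apply/funext => w.
rewrite /law -[X in _ = _ * fine X]/(mnormalize mu \d_point
  (itinerary shift N (trunc_letter m0) @^-1` [set w])).
rewrite mnormalizeE// fineM//; last exact: (mu_fin mu_le1 (measurable_cell w)).
by rewrite /= mulrCA divff ?mulr1// gt_eqF.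
Qed.

Lemma limit_entropy_ge0 : (0 <= limit_entropy)%E.
Proof.
rewrite /limit_entropy; case: ifPn => // l0; apply: mule_ge0 => //.
have l1 : 0 < lam.
  by rewrite lt_neqAle lam_ge0 andbT eq_sym; move: l0; rewrite mu_setTE eqe.
have mt := @observable_trunc_letter _ tA 0%N.
apply: le_trans (le_ks_entropy (@measurable_shift _ tA) (mnormalize_inv l1) mt).
rewrite lee_fin; apply: limr_ge.
  by apply/cvg_ex; eexists; exact: (cvg_entropy_rate (@measurable_shift _ tA) (mnormalize_inv l1) mt).
by apply: nearW => n; rewrite divr_ge0// block_entropy_ge0//; exact: measurable_shift.
Qed.

(** For [mu] nonzero the N-block sums are [lam] times the N-block entropies of the
normalization of [mu], up to an additive constant. *)
Lemma cell_mass_rate_cvg m0 (c : R) : exists2 l : R, (l%:E <= limit_entropy)%E &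
  (fun N => (shannon (@cell_mass m0 N) + c) / N%:R) @ \oo --> l.
Proof.
rewrite /limit_entropy; have [l0|l0] := eqVneq lam 0.
  rewrite mu_setTE l0 eqxx; exists 0 => //.
  have -> : (fun N => (shannon (@cell_mass m0 N) + c) / N%:R) = fun N => c * N%:R^-1.
    apply/funext => N; congr (_ * _); rewrite /shannon big1 ?oppr0 ?add0r// => w _.
    have mw := measurable_cell w.
    suff -> : cell_mass w = 0 by rewrite mul0r.
    rewrite /cell_mass.
    suff -> : mu (itinerary shift N (trunc_letter (tA := tA) m0) @^-1` [set w]) = 0%E.
      by [].
    apply/eqP; rewrite eq_le measure_ge0 andbT.
    have -> : 0%E = mu setT by rewrite mu_setTE l0.
    by apply: le_measure => //; exact: mem_set.
  rewrite -[X in _ --> X](mulr0 c); apply: cvgMr; exact: cvg_inv_nat.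
have l1 : 0 < lam by rewrite lt_neqAle lam_ge0 andbT eq_sym.
have mt := @observable_trunc_letter _ tA m0.
rewrite mu_setTE eqe (negbTE l0).
exists (lam * entropy_rate (mnormalize mu \d_point) shift (trunc_letter (tA := tA) m0)).
  rewrite EFinM lee_wpmul2l ?lee_fin ?lam_ge0//.
  exact: (le_ks_entropy (@measurable_shift _ tA) (mnormalize_inv l1) mt).
have -> : (fun N => (shannon (@cell_mass m0 N) + c) / N%:R) =
  fun N => lam *
      (block_entropy (mnormalize mu \d_point) shift (trunc_letter (tA := tA) m0) N / N%:R)
    + (c - lam * ln lam) * N%:R^-1.
  by apply/funext => N; rewrite shannon_cell_mass//; ring.
rewrite -[X in _ --> X]addr0; apply: cvgD.
  apply: cvgMr; exact: (cvg_entropy_rate (@measurable_shift _ tA) (mnormalize_inv l1) mt).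
rewrite -[X in _ --> X](mulr0 (c - lam * ln lam)); apply: cvgMr; exact: cvg_inv_nat.
Qed.

(** Let N tend to infinity in [limsup_ks_block]. *)
Lemma limsup_ks_rate q m0 (kappa : R) : 0 <= kappa ->
  (forall n, (ks_entropy shift (mu_ n) <=
    (entropy_rate (mu_ n) shift (trunc_letter (tA := tA) m0) +
      kappa * fine (mu_ n [set x : X | (q <= letter 0 x)%N]))%:E)%E) ->
  (limn_esup (fun n => ks_entropy shift (mu_ n)) <=
    limit_entropy + (kappa * (1 - fine (mu [set x : X | (letter 0 x < q)%N])))%:E)%E.
Proof.
move=> k0 h; set s := fine _.
have [l ll cl] := cell_mass_rate_cvg m0 2.
apply: (@le_trans _ _ (l + kappa * (1 - s))%:E); last by rewrite EFinD leeD2r.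
suff H (e : R) : 0 < e ->
    (limn_esup (fun n => ks_entropy shift (mu_ n)) <= (l + kappa * (1 - s) + e)%:E)%E.
  by apply/lee_addgt0Pr => e; exact: H.
move=> e0.
have e2 : 0 < e / 2 by rewrite divr_gt0.
pose d := Num.min 1 (e / 2 / (kappa + 1)).
have k1 : 0 < kappa + 1 by rewrite ltr_wpDl.
have d0 : 0 < d by rewrite /d lt_min ltr01 divr_gt0.
have d1 : d <= 1 by rewrite /d ge_min lexx.
have d2 : d * (kappa + 1) <= e / 2 by rewrite -ler_pdivlMr// /d ge_min lexx orbT.
move/cvgrPdist_le : cl => /(_ _ e2)[N0 _ hN].
have := hN N0.+1 (leqnSn N0); rewrite /= distrC => /(le_trans (ler_norm _)) h1.
apply: le_trans (limsup_ks_block (ltn0Sn N0) k0 d0 h) _.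
rewrite lee_fin -/s.
have h2 : (shannon (@cell_mass m0 N0.+1) + 1 + d) / N0.+1%:R <=
    (shannon (@cell_mass m0 N0.+1) + 2) / N0.+1%:R.
  by rewrite ler_pM2r ?invr_gt0 ?ltr0n//; lra.
have h3 : kappa * d <= e / 2.
  by apply: le_trans d2; rewrite mulrC ler_wpM2l ?(ltW d0)// lerDl.
rewrite mulrDr; move: h1 h2 h3.
move: ((_ + 1 + d) / _) ((_ + 2) / _) (kappa * _) (kappa * d) => u v x y; lra.
Qed.

Lemma mu_letter_lt (e : R) : 0 < e -> exists q0, forall q, (q0 <= q)%N ->
  lam - e <= fine (mu [set x : X | (letter 0 x < q)%N]).
Proof.
move=> e0.
have mB q : measurable [set x : X | (letter 0 x < q)%N].
  exact: (measurable_letter 0 [set c | (c < q)%N]).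
have : (mu \o (fun q => [set x : X | (letter 0 x < q)%N])) @ \oo --> mu setT.
  have -> : [set: X] = \bigcup_q [set x : X | (letter 0 x < q)%N].
    by apply/seteqP; split => // x _; exists (letter 0 x).+1 => /=.
  apply: nondecreasing_cvg_mu => //; first exact: bigcupT_measurable.
  by move=> m n mn; apply/subsetPset => x /= /leq_trans; apply.
rewrite mu_setTE => /fine_cvgP[_ /cvgrPdist_le/(_ _ e0)[q0 _ h]].
exists q0 => q /h /= /(le_trans (ler_norm _)); lra.
Qed.

End limit.

Local Open Scope ereal_scope.

Theorem theorem1p1 (R : realType) (A : rel nat) (tA : cms_transitive A)
    (a : nat) (htop : gurevich_entropy R tA a < +oo)
    (mu_ : nat -> probability (cms tA) R)
    (mu_inv : forall n, invariant_measure (@cms_shift A tA) (mu_ n))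
    (mu : {measure set (cms tA) -> \bar R})
    (mu_inv_lim : invariant_measure (@cms_shift A tA) mu)
    (mu_le1 : mu setT <= 1)
    (mu_cvg : forall w : seq nat, (0 < size w)%N -> sorted A w ->
       (fun n => mu_ n (cylinder tA w)) @ \oo --> mu (cylinder tA w)) :
  limn_esup (fun n => ks_entropy (@cms_shift A tA) (mu_ n)) <=
    (if mu setT == 0 then delta_infty R tA
     else mu setT * ks_entropy (@cms_shift A tA) (mnormalize mu \d_point)
          + (1 - mu setT) * delta_infty R tA).
Proof.
have muE := mu_setTE mu_le1.
have lam1 := lam_le1 mu_le1.
have lam0 := lam_ge0 mu.
set lam : R := fine (mu setT) in muE lam1 lam0.
set D := delta_infty R tA.
set L := limn_esup _.
have K0 := limit_entropy_ge0 mu_inv_lim mu_le1.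
set K := limit_entropy mu in K0.
have D0 : 0 <= D.
  apply: limn_einf_ge; exists 1%N => // q /= q0.
  apply: limn_einf_ge; apply: nearW => M.
  exact: (delta_infty_Mq_ge0 htop).
have -> : (if mu setT == 0 then D
    else mu setT * ks_entropy (@cms_shift A tA) (mnormalize mu \d_point)
      + (1 - mu setT) * D) = K + (1 - lam)%:E * D.
  rewrite /K /limit_entropy muE; case: ifPn => [/eqP[->]|_]; last by rewrite EFinB.
  by rewrite subr0 mul1e add0e.
have main (q M : nat) (kappa e : R) : (0 < q)%N -> (0 <= kappa)%R ->
    escaping_bound A M q kappa ->
    (lam - e <= fine (mu [set x : cms tA | (letter 0 x < q)%N]))%R ->
    L <= K + (kappa * (1 - lam + e))%:E.
  move=> q0 k0 hB hq; have [m0 qm0 h] := ks_entropy_truncation htop q0 k0 hB.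
  apply: le_trans (limsup_ks_rate mu_inv mu_inv_lim mu_le1 mu_cvg k0
    (fun n => h (mu_ n) (mu_inv n))) _.
  by rewrite leeD2l// lee_fin ler_wpM2l//; lra.
have [lam_eq1|lam_ne1] := eqVneq lam 1%R.
  (* 0 * D = 0 even when D = +oo, so the bound needs a rate uniform in q. *)
  rewrite lam_eq1 subrr mul0e adde0; apply/lee_addgt0Pr => e e0.
  have [H [H0 hH]] := escaping_bound_entropy htop.
  have H1 : (0 < H + 1)%R by rewrite ltr_wpDl.
  have d0 : (0 < e / (H + 1))%R by rewrite divr_gt0.
  have [q0 hq0] := mu_letter_lt mu_le1 d0.
  apply: le_trans (main q0.+1 0%N H _ _ H0 (hH _) (hq0 _ (leqnSn _))) _ => //.
  rewrite leeD2l// lee_fin lam_eq1 subrr add0r mulrA ler_pdivrMr//; nra.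
have lam_lt1 : (lam < 1)%R by rewrite lt_neqAle lam_ne1.
case DE : D D0 => [r| |//] D0; last first.
  rewrite gt0_muley ?lte_fin ?subr_gt0// addey ?leey//.
  by rewrite gt_eqF// (lt_le_trans _ K0)// ltNyr.
rewrite lee_fin in D0.
apply/lee_addgt0Pr => e e0.
pose d : R := Num.min 1%R (e / (r + 2))%R.
have r2 : (0 < r + 2)%R by lra.
have d0 : (0 < d)%R by rewrite /d lt_min ltr01 divr_gt0.
have d1 : (d <= 1)%R by rewrite /d ge_min lexx.
have d2 : (d * (r + 2) <= e)%R by rewrite -ler_pdivlMr// /d ge_min lexx orbT.
have [q0 hq0] := mu_letter_lt mu_le1 d0.
have Dd : D < (r + d)%:E by rewrite DE lte_fin ltrDl.
have [q qq hq] := limn_einf_lt q0.+1 Dd.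
have [M _ hM] := limn_einf_lt 0 hq.
have hB := escaping_bound_delta hM.
have rd0 : (0 <= r + d)%R by rewrite addr_ge0// ltW.
apply: (le_trans (main q M (r + d)%R d (leq_trans (ltn0Sn q0) qq) rd0 hB
  (hq0 q (ltnW qq)))).
rewrite -addeA leeD2l// -EFinM -EFinD lee_fin.
have l0 : (0 <= d * lam)%R by rewrite mulr_ge0// ltW.
have dd : (d * d <= d)%R by rewrite ler_piMr// ltW.
by move: d2 l0 dd; clear; move: d lam => d lam; lra.
Qed.
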